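(* Let $\widetilde{W}$ be the affine Weyl group of type $\widetilde{B}_n$ and $w\in\widetilde{W}^S$. For $n\ge4$, $w$ is palindromic if and only if $\pi(w)$ is a one-row shape $(j)$ with $0\le j<2n$ or a staircase shape $(k,k-1,k-2,\dots,1)$ with $1<k<n$. For $n=3$, $w$ is palindromic if and only if $\pi(w)$ is a one-row shape, or the staircase shape $(2,1)$, or the square $(3,3,3)$.
   Context: $\widetilde{W}$ ($n\ge3$) has generators $s_0,\dots,s_n$ with $m(s_0,s_2)=m(s_1,s_2)=3$, $m(s_i,s_{i+1})=3$ ($2\le i\le n-2$), $m(s_{n-1},s_n)=4$, all other pairs commuting. $S=\{s_1,\dots,s_n\}$, $S'=\{s_0,s_2,\dots,s_n\}$; $\widetilde{W}^S$, $\widetilde{W}^{S'}$ are the sets of minimal length left coset representatives for $W_S$, $W_{S'}$. Segments ($1\le j\le 2n-1$): $\sigma_1(j)=s_j\cdots s_2s_1$ ($j\le n$), $\sigma_1(j)=s_{2n-j}\cdots s_{n-1}s_ns_{n-1}\cdots s_2s_1$ ($n<j$); $\sigma_0(j)$ is obtained from $\sigma_1(j)$ by replacing every $s_1$ by $s_0$. Every $w\in\widetilde{W}^S$, $w\ne\mathrm{id}$, factors uniquely $w=uv$ with $u\in\widetilde{W}^{S'}$, $v\in W_{S'}$, lengths adding, and $v=\sigma_0(\lambda_1)$; if $u\neq\mathrm{id}$, $u=u'v'$ with $u'\in\widetilde{W}^S$, $v'=\sigma_1(\lambda_2)\in W_S$; continuing alternately gives $w=\cdots\sigma_0(\lambda_3)\sigma_1(\lambda_2)\sigma_0(\lambda_1)$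 and $\pi(w)=(\lambda_1,\lambda_2,\dots)$, $\pi(\mathrm{id})=\emptyset=(0)$; $\pi(w)$ is a partition of $\ell(w)$. $P_w(t)=\sum_{v\in\widetilde{W}^S, v\le w}t^{\ell(v)}$ (Bruhat order); $w$ is palindromic if the coefficients satisfy $a_i=a_{\ell(w)-i}$ for all $i$. *)

(* Defs.v *)
From HB Require Import structures.
From mathcomp Require Import all_boot all_order all_algebra.
From mathcomp Require Import boolp classical_sets functions cardinality fsbigop.

Set Implicit Arguments.
Unset Strict Implicit.
Unset Printing Implicit Defensive.

Local Open Scope classical_set_scope.
Local Open Scope group_scope.

(* The Coxeter group < I | (s_i s_j)^(m i j) = 1 >, for a Coxeter matrix m
   (with m i i = 1), as words in I modulo the congruence generated by the
   relations.  As the generators are involutions, reversing a word inverts it;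
   the two hypotheses needed for this are packed with m. *)
Record coxmat (I : Type) := CoxMat {
  cox_m :> I -> I -> nat;
  cox_diag : forall i, cox_m i i = 1%N;
  cox_sym : forall i j, cox_m i j = cox_m j i }.

Inductive cox_eq (I : Type) (m : coxmat I) : seq I -> seq I -> Prop :=
| cox_eq_refl u : cox_eq m u u
| cox_eq_sym u v : cox_eq m u v -> cox_eq m v u
| cox_eq_trans u v w : cox_eq m u v -> cox_eq m v w -> cox_eq m u w
| cox_eq_rel u v i j :
    cox_eq m (u ++ flatten (nseq (m i j) [:: i; j]) ++ v) (u ++ v).

Definition cox_eqb (I : Type) (m : coxmat I) : rel (seq I) :=
  fun u v => `[< cox_eq m u v >].

Lemma cox_eqb_refl (I : Type) (m : coxmat I) : reflexive (cox_eqb m).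
Proof. by move=> u; apply/asboolP; apply: cox_eq_refl. Qed.

Lemma cox_eqb_sym (I : Type) (m : coxmat I) : symmetric (cox_eqb m).
Proof.
by move=> u v; apply/asboolP/asboolP; apply: cox_eq_sym.
Qed.

Lemma cox_eqb_trans (I : Type) (m : coxmat I) : transitive (cox_eqb m).
Proof.
move=> v u w /asboolP uv /asboolP vw; apply/asboolP.
exact: cox_eq_trans uv vw.
Qed.

Canonical cox_equiv (I : Type) (m : coxmat I) :=
  EquivRel (cox_eqb m) (@cox_eqb_refl I m) (@cox_eqb_sym I m)
    (@cox_eqb_trans I m).

Definition coxeter (I : choiceType) (m : coxmat I) : Type :=
  {eq_quot (cox_eqb m)}%qT.

HB.instance Definition _ (I : choiceType) (m : coxmat I) :=
  Choice.on (coxeter m).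
HB.instance Definition _ (I : choiceType) (m : coxmat I) :=
  EqQuotient.on (coxeter m).

Definition cox_class (I : choiceType) (m : coxmat I) (u : seq I) : coxeter m :=
  (\pi_(coxeter m) u)%qT.

Lemma cox_classP (I : choiceType) (m : coxmat I) (u v : seq I) :
  cox_class m u = cox_class m v <-> cox_eq m u v.
Proof.
rewrite /cox_class; split.
  by move/eqP; rewrite eqmodE => /asboolP.
by move=> uv; apply/eqP; rewrite eqmodE; apply/asboolP.
Qed.

Lemma cox_class_repr (I : choiceType) (m : coxmat I) (x : coxeter m) :
  cox_class m (repr x) = x.
Proof. by rewrite /cox_class reprK. Qed.

Lemma cox_eq_catl (I : Type) (m : coxmat I) (w u v : seq I) :
  cox_eq m u v -> cox_eq m (w ++ u) (w ++ v).
Proof.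
elim=> [x|x y _|x y z _ xy _|x y i j].
- exact: cox_eq_refl.
- exact: cox_eq_sym.
- exact: cox_eq_trans xy.
- by rewrite !(catA w); apply: cox_eq_rel.
Qed.

Lemma cox_eq_catr (I : Type) (m : coxmat I) (w u v : seq I) :
  cox_eq m u v -> cox_eq m (u ++ w) (v ++ w).
Proof.
elim=> [x|x y _|x y z _ xy _|x y i j].
- exact: cox_eq_refl.
- exact: cox_eq_sym.
- exact: cox_eq_trans xy.
- by rewrite -!catA; apply: cox_eq_rel.
Qed.

Lemma rev_alternate (T : Type) (k : nat) (i j : T) :
  rev (flatten (nseq k [:: i; j])) = flatten (nseq k [:: j; i]).
Proof.
elim: k => //= k IH; rewrite -cat1s -[j :: _]cat1s !rev_cat IH.
by elim: k {IH} => //= k ->.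
Qed.

Lemma cox_eq_rev (I : Type) (m : coxmat I) (u v : seq I) :
  cox_eq m u v -> cox_eq m (rev u) (rev v).
Proof.
elim=> [x|x y _|x y z _ xy _|x y i j].
- exact: cox_eq_refl.
- exact: cox_eq_sym.
- exact: cox_eq_trans xy.
- by rewrite !rev_cat rev_alternate -catA cox_sym; apply: cox_eq_rel.
Qed.

Lemma cox_eq_revl (I : Type) (m : coxmat I) (u : seq I) :
  cox_eq m (rev u ++ u) [::].
Proof.
elim: u => [|i u IH]; first exact: cox_eq_refl.
apply: cox_eq_trans IH; rewrite rev_cons cat_rcons.
by have := cox_eq_rel m (rev u) u i i; rewrite cox_diag.
Qed.

Definition cox_one (I : choiceType) (m : coxmat I) : coxeter m :=
  cox_class m [::].
Definition cox_mul (I : choiceType) (m : coxmat I) (x y : coxeter m) :=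
  cox_class m (repr x ++ repr y).
Definition cox_inv (I : choiceType) (m : coxmat I) (x : coxeter m) :=
  cox_class m (rev (repr x)).

Lemma cox_repr_class (I : choiceType) (m : coxmat I) (u : seq I) :
  cox_eq m (repr (cox_class m u)) u.
Proof. by apply/cox_classP; rewrite cox_class_repr. Qed.

Lemma cox_mul_class (I : choiceType) (m : coxmat I) (u v : seq I) :
  cox_mul (cox_class m u) (cox_class m v) = cox_class m (u ++ v).
Proof.
apply/cox_classP; apply: (@cox_eq_trans _ _ _ (u ++ repr (cox_class m v))).
  exact/cox_eq_catr/cox_repr_class.
exact/cox_eq_catl/cox_repr_class.
Qed.

Lemma cox_inv_class (I : choiceType) (m : coxmat I) (u : seq I) :
  cox_inv (cox_class m u) = cox_class m (rev u).
Proof. exact/cox_classP/cox_eq_rev/cox_repr_class. Qed.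

Lemma cox_mulA (I : choiceType) (m : coxmat I) : associative (@cox_mul I m).
Proof.
move=> x y z; rewrite -(cox_class_repr x) -(cox_class_repr y).
by rewrite -(cox_class_repr z) !cox_mul_class catA.
Qed.

Lemma cox_mul1 (I : choiceType) (m : coxmat I) :
  left_id (cox_one m) (@cox_mul I m).
Proof. by move=> x; rewrite -(cox_class_repr x) cox_mul_class. Qed.

Lemma cox_mul1r (I : choiceType) (m : coxmat I) :
  right_id (cox_one m) (@cox_mul I m).
Proof. by move=> x; rewrite -(cox_class_repr x) cox_mul_class cats0. Qed.

Lemma cox_mulV (I : choiceType) (m : coxmat I) :
  left_inverse (cox_one m) (@cox_inv I m) (@cox_mul I m).
Proof.
move=> x; rewrite -(cox_class_repr x) cox_inv_class cox_mul_class.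
exact/cox_classP/cox_eq_revl.
Qed.

Lemma cox_mulVr (I : choiceType) (m : coxmat I) :
  right_inverse (cox_one m) (@cox_inv I m) (@cox_mul I m).
Proof.
move=> x; rewrite -(cox_class_repr x) cox_inv_class cox_mul_class.
apply/cox_classP; rewrite -{1}(revK (repr x)); exact: cox_eq_revl.
Qed.

HB.instance Definition _ (I : choiceType) (m : coxmat I) :=
  isGroup.Build (coxeter m) (@cox_mulA I m) (@cox_mul1 I m) (@cox_mul1r I m)
    (@cox_mulV I m) (@cox_mulVr I m).

Definition gen (I : choiceType) (m : coxmat I) (i : I) : coxeter m :=
  cox_class m [:: i].

Definition wprod (I : choiceType) (m : coxmat I) (u : seq I) : coxeter m :=
  \prod_(i <- u) gen m i.

Lemma wprodE (I : choiceType) (m : coxmat I) (u : seq I) :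
  wprod m u = cox_class m u.
Proof.
rewrite /wprod; elim: u => [|i u IH]; first by rewrite big_nil.
by rewrite big_cons IH [LHS]cox_mul_class.
Qed.

Lemma wprod_surj (I : choiceType) (m : coxmat I) (w : coxeter m) :
  exists u, wprod m u = w.
Proof. by exists (repr w); rewrite wprodE cox_class_repr. Qed.

Lemma ell_subproof (I : choiceType) (m : coxmat I) (w : coxeter m) :
  exists k, `[< exists2 u, size u = k & wprod m u = w >].
Proof.
have [u uw] := wprod_surj w.
by exists (size u); apply/asboolP; exists u.
Qed.

Definition ell (I : choiceType) (m : coxmat I) (w : coxeter m) : nat :=
  ex_minn (ell_subproof w).

Definition reflection (I : choiceType) (m : coxmat I) (t : coxeter m) : Prop :=
  exists (x : coxeter m) (i : I), t = x * gen m i * x^-1.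

Inductive bruhat (I : choiceType) (m : coxmat I) (v : coxeter m) :
    coxeter m -> Prop :=
| bruhat_refl : bruhat v v
| bruhat_step w t : bruhat v w -> reflection t -> (ell w < ell (w * t)%g)%N ->
    bruhat v (w * t).

(* No inverses are needed to generate W_J, the generators being involutions. *)
Definition parabolic (I : choiceType) (m : coxmat I) (J : pred I)
    (x : coxeter m) : Prop :=
  exists2 u, all J u & wprod m u = x.

Definition min_rep (I : choiceType) (m : coxmat I) (J : pred I)
    (w : coxeter m) : Prop :=
  forall x, parabolic J x -> (ell w <= ell (w * x)%g)%N.

Definition lower_ideal (I : choiceType) (m : coxmat I) (J : pred I)
    (w : coxeter m) : set (coxeter m) :=
  [set v | min_rep J v /\ bruhat v w].

Definition poincare (I : choiceType) (m : coxmat I) (J : pred I)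
    (w : coxeter m) : {poly int} :=
  (\sum_(v \in lower_ideal J w) ('X^(ell v) : {poly int}))%R.

(* The sum defining poincare would be 0 on an infinite index set; for a finite
   set of generators this does not happen. *)
Lemma finite_lower_ideal (I : finType) (m : coxmat I) (J : pred I)
  (w : coxeter m) : finite_set (lower_ideal J w).
Proof.
have le_ell v : bruhat v w -> (ell v <= ell w)%N.
  by elim=> // x t _ le_vx _ /ltnW; apply: leq_trans.
apply: (@sub_finite_set _ _
  ((fun u : {k : 'I_(ell w).+1 & (k : nat).-tuple I} => wprod m (tagged u))
    @` setT)); last exact/finite_image/finite_finset.
move=> v [_ /le_ell le_vw].
have [u uv uE] : exists2 u, size u = ell v & wprod m u = v.
  by rewrite /ell; case: ex_minnP => k /asboolP.
have lt_u : (size u < (ell w).+1)%N by rewrite uv ltnS.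
by exists (@Tagged _ (Ordinal lt_u) (fun k => (k : nat).-tuple I) (in_tuple u)).
Qed.

Definition palindromic (I : choiceType) (m : coxmat I) (J : pred I)
    (w : coxeter m) : Prop :=
  forall i : nat, (i <= ell w)%N ->
    ((poincare J w)`_i = (poincare J w)`_(ell w - i))%R.

(* Bonds of the affine diagram of type B_n between the nodes i < j. *)
Definition affB_bond (n i j : nat) : nat :=
  (if (j == 2) && (i < 2) then 3
   else if [&& 2 <= i, i <= n - 2 & j == i.+1] then 3
   else if (i == n.-1) && (j == n) then 4
   else 2)%N.

Definition affB_m (n : nat) (i j : 'I_n.+1) : nat :=
  if i == j then 1%N else affB_bond n (minn i j) (maxn i j).

Lemma affB_diag (n : nat) (i : 'I_n.+1) : affB_m i i = 1%N.
Proof. by rewrite /affB_m eqxx. Qed.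

Lemma affB_sym (n : nat) (i j : 'I_n.+1) : affB_m i j = affB_m j i.
Proof. by rewrite /affB_m eq_sym minnC maxnC. Qed.

Definition affB_mat (n : nat) : coxmat 'I_n.+1 :=
  CoxMat (@affB_diag n) (@affB_sym n).

Definition affB (n : nat) := coxeter (affB_mat n).

(* The generators other than s_0 (the set S) for b = false, and the generators
   other than s_1 (the set S') for b = true. *)
Definition omit (n : nat) (b : bool) : pred 'I_n.+1 :=
  fun i => (i : nat) != b.

Definition segment_word (n j : nat) : seq nat :=
  if (j <= n)%N then rev (iota 1 j)
  else iota (2 * n - j)%N (j - n)%N ++ rev (iota 1 n).

(* sigma_1(j) for b = true, sigma_0(j) for b = false. *)
Definition segment (n : nat) (b : bool) (j : nat) : affB n :=
  wprod (affB_mat n)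
    [seq inord (if k == 1%N then b : nat else k) | k <- segment_word n j].

(* affB_shape b w la: la lists the parts read off by the alternating parabolic
   factorization of w, starting with a factorization w = u sigma_b(la_1) for
   w a minimal representative modulo the generators other than s_b. *)
Inductive affB_shape (n : nat) : bool -> affB n -> seq nat -> Prop :=
| affB_shape_nil b : affB_shape b 1 [::]
| affB_shape_cons b (w u : affB n) (j : nat) (la : seq nat) :
    w <> 1 -> min_rep (omit b) w ->
    min_rep (omit (~~ b)) u -> parabolic (omit (~~ b)) (segment n b j) ->
    (1 <= j <= 2 * n - 1)%N ->
    w = u * segment n b j ->
    ell w = (ell u + ell (segment n b j))%N ->
    affB_shape (~~ b) u la ->
    affB_shape b w (j :: la).

(* The default value of xget is irrelevant: every minimal representative modulo
   W_S has exactly one shape. *)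
Definition affB_pi (n : nat) (w : affB n) : seq nat :=
  xget [::] [set la | affB_shape false w la].

(* Partitions are lists of positive parts, so the shape (0) is the empty list. *)
Definition one_row (j : nat) : seq nat := if j == 0%N then [::] else [:: j].

Definition staircase (k : nat) : seq nat := rev (iota 1 k).

(* Main.v *)
(** Write W^S for the minimal coset representatives. An element of W^S is determined
    by the image of the origin under the action of W on Z^n, and firing a wall that is
    positive at that point moves one step up in W^S (the numbers game of Tits and
    Mozes, which needs only the strong exchange condition and a rank two check).
    Hence the length of an element of W^S is the number of hyperplanes strictly
    separating its point from the base alcove, and a reflection that decreases this
    number leads to an element that is smaller in Bruhat order. In terms of words, the
    shapes of elements of W^S are the partitions with parts at most 2n-1 whose parts
    below n are distinct, and containment of shapes implies Bruhat order.
    W^S has one element of length 1, one of length 2 and, for n >= 4, two of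
    length 4, so a palindromic shape has one coatom and one element of corank 2. Lowering
    single parts produces two such elements except for one row shapes, staircases,
    (n,...,n) and (n,...,n,n-1,...,1). For the last two families a further coatom or
    element of corank 2 is a reflected point; only (n^n) escapes, and it has three
    elements of corank 4. Conversely one row shapes have a chain below them, the
    ideal of a staircase consists of the subsets of {1,...,k} and is symmetric under
    complement, and the ideal of (3,3,3) for n = 3 is computed. *)

Require Import Defs.
From mathcomp Require Import all_boot all_order all_algebra.
From mathcomp Require Import boolp classical_sets cardinality fsbigop finmap.
From mathcomp Require Import zify ring.

Set Implicit Arguments.
Unset Strict Implicit.
Unset Printing Implicit Defensive.

Arguments ell {I m} w%_g.

Lemma cat_eq_cat_cons (T : Type) (s1 s2 t1 t2 : seq T) (x : T) :
  s1 ++ s2 = t1 ++ x :: t2 ->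
  (exists r, s1 = t1 ++ x :: r /\ t2 = r ++ s2) \/
  (exists r, t1 = s1 ++ r /\ s2 = r ++ x :: t2).
Proof.
elim: s1 t1 => [|y s1 IH] [|z t1] /=.
- by move=> ->; right; exists [::].
- by move=> ->; right; exists (z :: t1).
- by case=> <- <-; left; exists s1.
- case=> <- /IH[[r [-> ->]]|[r [-> ->]]]; first by left; exists r.
  by right; exists r.
Qed.

Lemma subseq_cat_split (T : eqType) (s s1 s2 : seq T) : subseq s (s1 ++ s2) ->
  exists r1 r2, [/\ subseq r1 s1, subseq r2 s2 & s = r1 ++ r2].
Proof.
case/subseqP=> b sz ->; have sz1 : size (take (size s1) b) = size s1.
  by rewrite size_takel // sz size_cat leq_addr.
exists (mask (take (size s1) b) s1), (mask (drop (size s1) b) s2).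
by split; rewrite ?mask_subseq // -mask_cat // cat_take_drop.
Qed.

Lemma all2_refl (T : Type) (e : rel T) (s : seq T) : reflexive e -> all2 e s s.
Proof. by move=> e_refl; elim: s => //= x s ->; rewrite e_refl. Qed.

Lemma all2_cat (T S : Type) (e : T -> S -> bool) (s1 s2 : seq T) (t1 t2 : seq S) :
  all2 e s1 t1 -> all2 e s2 t2 -> all2 e (s1 ++ s2) (t1 ++ t2).
Proof. by elim: s1 t1 => [|x s1 IH] [|y t1] //= /andP[-> /IH] IHs /IHs. Qed.

Lemma nseqSr (T : Type) (k : nat) (x : T) : nseq k.+1 x = nseq k x ++ [:: x].
Proof. by rewrite -addn1 nseqD. Qed.

Lemma gtn_trans : transitive gtn.
Proof. by move=> y x z /= yx zy; apply: ltn_trans zy yx. Qed.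

Lemma not_sorted_split (T : Type) (e : rel T) (s : seq T) : ~~ sorted e s ->
  exists s1 x y s2, s = s1 ++ [:: x, y & s2] /\ ~~ e x y.
Proof.
case: s => //= x s; elim: s x => //= y s IH x; rewrite negb_and.
case/orP=> [ne|/IH[s1 [a [b [s2 [-> ne]]]]]]; first by exists [::], x, y, s.
by exists (x :: s1), a, b, s2.
Qed.

Lemma mask_uniq_inj (T : eqType) (s : seq T) (b b' : bitseq) : uniq s ->
  size b = size s -> size b' = size s -> mask b s = mask b' s -> b = b'.
Proof.
case: s => [|x s] us sb sb' eq_mask; first by rewrite (size0nil sb) (size0nil sb').
apply: (@eq_from_nth _ false); rewrite sb // => i lti.
have := congr1 (fun r => nth x (x :: s) i \in r) eq_mask.
by rewrite !in_mask // mem_nth // index_uniq.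
Qed.

Lemma sumn_mask_negb (s : seq nat) (b : bitseq) : size b = size s ->
  sumn (mask b s) + sumn (mask (map negb b) s) = sumn s.
Proof.
elim: s b => [|x s IH] [|c b] //= [sb]; have := IH b sb.
by case: c => /=; lia.
Qed.

Lemma sumn_eq0_positive (s : seq nat) : all (leq 1) s -> sumn s = 0 -> s = [::].
Proof. by case: s => //= x s /andP[]; lia. Qed.

Fixpoint alternating (T : Type) (x y : T) (k : nat) : seq T :=
  if k is k'.+1 then x :: alternating y x k' else [::].

Section AlternatingSequences.
Variable T : Type.
Implicit Types (x y : T).

Lemma size_alternating x y k : size (alternating x y k) = k.
Proof. by elim: k x y => //= k IH x y; rewrite IH. Qed.

Lemma alternating_double x y k :
  alternating x y k.*2 = flatten (nseq k [:: x; y]).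
Proof. by elim: k => //= k <-. Qed.

Lemma alternatingD x y k l : alternating x y (k + l) =
  alternating x y k ++ (if odd k then alternating y x l else alternating x y l).
Proof. by elim: k x y => //= k IH x y; rewrite IH; case: odd. Qed.

Lemma rev_alternating x y k :
  rev (alternating x y k) = if odd k then alternating x y k else alternating y x k.
Proof.
elim: k x y => //= k IH x y; rewrite rev_cons IH -cats1.
have := alternatingD x y k 1; have := alternatingD y x k 1; rewrite addn1 /=.
by case: odd.
Qed.

End AlternatingSequences.

(** * Exchange, Bruhat order and minimal coset representatives *)

Section CoxeterGroups.
Local Open Scope group_scope.
Variables (I : choiceType) (m : coxmat I).
Implicit Types (u v a : seq I) (w x y t : coxeter m) (i j : I).
Local Notation s := (gen m).
Local Notation wp := (wprod m).

Lemma wprod_nil : wp [::] = 1.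
Proof. by rewrite /wprod big_nil. Qed.

Lemma wprod_cons i u : wp (i :: u) = s i * wp u.
Proof. by rewrite /wprod big_cons. Qed.

Lemma wprod_cat u v : wp (u ++ v) = wp u * wp v.
Proof. by rewrite /wprod big_cat. Qed.

Lemma wprod1 i : wp [:: i] = s i.
Proof. by rewrite wprodE. Qed.

Lemma wprod_rcons u i : wp (rcons u i) = wp u * s i.
Proof. by rewrite -cats1 wprod_cat wprod1. Qed.

Lemma wprod_eqP u v : wp u = wp v <-> cox_eq m u v.
Proof. by rewrite !wprodE; apply: cox_classP. Qed.

Lemma gen_sq i : s i * s i = 1.
Proof.
rewrite -!wprod1 -wprod_cat -wprod_nil; apply/wprod_eqP.
by have := cox_eq_rel m [::] [::] i i; rewrite cox_diag.
Qed.

Lemma genV i : (s i)^-1 = s i.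
Proof. by apply: mulg1_eq; apply: gen_sq. Qed.

Lemma mulg_genK w i : w * s i * s i = w.
Proof. by rewrite -mulgA gen_sq mulg1. Qed.

Lemma gen_mulgK w i : s i * (s i * w) = w.
Proof. by rewrite mulgA gen_sq mul1g. Qed.

Lemma wprod_rev u : wp (rev u) = (wp u)^-1.
Proof.
elim: u => [|i u IH]; first by rewrite wprod_nil invg1.
by rewrite rev_cons wprod_rcons IH wprod_cons invgM genV.
Qed.

Lemma wprod_relator i j : wp (alternating i j (m i j).*2) = 1.
Proof.
rewrite -wprod_nil alternating_double; apply/wprod_eqP.
by have := cox_eq_rel m [::] [::] i j; rewrite cats0.
Qed.

Lemma wprod_braid i j :
  wp (alternating i j (m i j)) = wp (alternating j i (m i j)).
Proof.
have := wprod_relator i j; rewrite -addnn alternatingD wprod_cat.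
move=> /eqP; rewrite mulg_eq1 -wprod_rev => /eqP->; rewrite fun_if !rev_alternating.
by case: odd.
Qed.

Lemma odd_size_wprod u v : wp u = wp v -> odd (size u) = odd (size v).
Proof.
move/wprod_eqP; elim=> // [x y z _ -> _ -> //|x y i j].
by rewrite !size_cat -alternating_double size_alternating !oddD odd_double.
Qed.

Lemma ell_wprod u : (ell (wp u) <= size u)%N.
Proof.
rewrite /ell; case: ex_minnP => k _; apply.
by apply/asboolP; exists u.
Qed.

Definition reduced u : Prop := size u = ell (wp u).

Lemma reduced_word w : exists2 u, wp u = w & size u = ell w.
Proof.
rewrite /ell; case: ex_minnP => k /asboolP[u su uw] _.
by exists u.
Qed.

Lemma odd_ell u : odd (ell (wp u)) = odd (size u).
Proof. by have [v /odd_size_wprod <- <-] := reduced_word (wp u). Qed.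

Lemma ell1 : ell (1 : coxeter m) = 0%N.
Proof. by apply/eqP; rewrite -leqn0 -wprod_nil ell_wprod. Qed.

Lemma ell_eq0 w : ell w = 0%N -> w = 1.
Proof. by have [[|i u] <- <-] := reduced_word w; rewrite ?wprod_nil. Qed.

Lemma ellM x y : (ell (x * y) <= ell x + ell y)%N.
Proof.
have [u <- <-] := reduced_word x; have [v <- <-] := reduced_word y.
by rewrite -wprod_cat -size_cat ell_wprod.
Qed.

Lemma ell_inv w : ell w^-1 = ell w.
Proof.
have ell_inv_le x : (ell x^-1 <= ell x)%N.
  by have [u <- <-] := reduced_word x; rewrite -wprod_rev -size_rev ell_wprod.
by apply/eqP; rewrite eqn_leq ell_inv_le /= -{1}(invgK w) ell_inv_le.
Qed.

Lemma ell_gen i : ell (s i) = 1%N.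
Proof.
have := odd_ell [:: i]; have := ell_wprod [:: i]; rewrite wprod1 /=.
by case: (ell _) => [|[]].
Qed.

Lemma odd_ellM x y : odd (ell (x * y)) = odd (ell x) (+) odd (ell y).
Proof.
have [u <- _] := reduced_word x; have [v <- _] := reduced_word y.
by rewrite -wprod_cat !odd_ell size_cat oddD.
Qed.

Lemma odd_ell_reflection t : reflection t -> odd (ell t).
Proof.
case=> x [i ->]; rewrite !odd_ellM ell_inv ell_gen.
by case: (odd _).
Qed.

Lemma reflectionV t : reflection t -> t^-1 = t.
Proof. by case=> x [i ->]; rewrite !invgM invgK genV !mulgA. Qed.

Lemma reflection_sq t : reflection t -> t * t = 1.
Proof. by move=> rt; rewrite -{1}(reflectionV rt) mulVg. Qed.

Lemma reflection_gen i : reflection (s i).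
Proof. by exists 1, i; rewrite mul1g invg1 mulg1. Qed.

Lemma reflection_conj x t : reflection t -> reflection (x * t * x^-1).
Proof. by case=> y [i ->]; exists (x * y), i; rewrite invgM !mulgA. Qed.

Lemma ell_mul_reflection_neq w t : reflection t -> ell (w * t) != ell w.
Proof.
move=> /odd_ell_reflection odd_t; apply/eqP => /(congr1 odd).
by rewrite odd_ellM odd_t; case: (odd _).
Qed.

Lemma ell_mul_gen w i :
  ell (w * s i) = (ell w).+1 \/ ell w = (ell (w * s i)).+1.
Proof.
have := ell_mul_reflection_neq w (reflection_gen i).
have := ellM w (s i); have := ellM (w * s i) (s i).
by rewrite mulg_genK ell_gen; lia.
Qed.

Lemma ell_gen_mul i w :
  ell (s i * w) = (ell w).+1 \/ ell w = (ell (s i * w)).+1.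
Proof.
by have := ell_mul_gen w^-1 i; rewrite -(ell_inv (s i * w)) invgM genV ell_inv.
Qed.

Lemma reduced_catl u v : reduced (u ++ v) -> reduced u.
Proof.
rewrite /reduced => red; apply/eqP; rewrite eqn_leq ell_wprod andbT.
have := ellM (wp u) (wp v); rewrite -wprod_cat -red size_cat.
by have := ell_wprod v; lia.
Qed.

Lemma reduced_catr u v : reduced (u ++ v) -> reduced v.
Proof.
rewrite /reduced => red; apply/eqP; rewrite eqn_leq ell_wprod andbT.
have := ellM (wp u) (wp v); rewrite -wprod_cat -red size_cat.
by have := ell_wprod u; lia.
Qed.

Lemma reduced_cons_lt i u : reduced (i :: u) -> (ell (wp u) < ell (s i * wp u))%N.
Proof.
move=> red; rewrite -wprod_cons -red -(reduced_catr (u := [:: i]) red).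
exact: ltnSn.
Qed.

(* The entry of [right_reflections u] at position p is the reflection t such
   that [wp u * t] is the product of [u] with its letter p deleted. *)
Fixpoint right_reflections u : seq (coxeter m) :=
  if u is i :: v then (wp v)^-1 * s i * wp v :: right_reflections v else [::].

Lemma right_reflections_cat u v : right_reflections (u ++ v) =
  [seq (wp v)^-1 * t * wp v | t <- right_reflections u] ++ right_reflections v.
Proof.
elim: u => //= i u ->; rewrite wprod_cat invgM; congr (_ :: _).
by rewrite !mulgA.
Qed.

Lemma right_reflections_delete u t : t \in right_reflections u ->
  exists u1 i u2, u = u1 ++ i :: u2 /\ wp u * t = wp (u1 ++ u2).
Proof.
elim: u => //= i u IH; rewrite inE => /orP[/eqP->|/IH[u1 [j [u2 [-> del]]]]].
  exists [::], i, u; split=> //=.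
  by rewrite wprod_cons !mulgA mulgK gen_sq mul1g.
exists (i :: u1), j, u2; split=> //=.
by rewrite wprod_cons -mulgA del wprod_cons.
Qed.

Lemma ell_right_reflections u t : t \in right_reflections u ->
  (ell (wp u * t) < size u)%N.
Proof.
case/right_reflections_delete=> u1 [i [u2 [-> ->]]].
by apply: leq_ltn_trans (ell_wprod _) _; rewrite !size_cat /= addnS.
Qed.

(* Read [u] as a gallery of chambers: [crosses u t] is the parity of the number
   of times it crosses the wall of t, hence depends on [wp u] only. *)
Definition crosses u t := odd (count_mem t (right_reflections u)).

Lemma crosses_mem u t : crosses u t -> t \in right_reflections u.
Proof. by rewrite /crosses -has_pred1 has_count; case: count. Qed.

Lemma crosses_cat u v t :
  crosses (u ++ v) t = crosses u (wp v * t * (wp v)^-1) (+) crosses v t.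
Proof.
rewrite /crosses right_reflections_cat count_cat oddD; congr (odd _ (+) _).
rewrite count_map; apply: eq_count => r /=.
apply/eqP/eqP => [<-|->]; first by rewrite !mulgA mulgK mulgV mul1g.
by rewrite !mulgA mulgVK mulVg mul1g.
Qed.

Lemma wprod_alternating_double i j k :
  wp (alternating i j k.*2) = (s i * s j) ^+ k.
Proof.
elim: k => [|k IH] /=; first by rewrite wprod_nil.
by rewrite !wprod_cons IH expgS !mulgA.
Qed.

Lemma dihedral_conj i j k :
  ((s i * s j) ^+ k)^-1 * s j * (s i * s j) ^+ k = s j * (s i * s j) ^+ k.*2.
Proof.
elim: k => [|k IH]; first by rewrite !expg0 invg1 mul1g.
rewrite expgSr invgM doubleS -!mulgA (mulgA _ (s j)) (mulgA (_ * s j)) IH.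
rewrite invgM !genV -(addn2 k.*2) (addnC _ 2) expgnDr expg2 !mulgA.
have := expgSr (s i * s j) k.*2; rewrite expgS => comm.
by rewrite -!mulgA !(mulgA (s i)) -comm !mulgA.
Qed.

Lemma right_reflections_alternating_double i j k :
  right_reflections (alternating i j k.*2) =
  rev (mkseq (fun q => s j * (s i * s j) ^+ q) k.*2).
Proof.
elim: k => //= k IH; rewrite !mkseqS !rev_rcons -IH.
rewrite wprod_cons wprod_alternating_double invgM genV; congr [:: _, _ & _].
  transitivity (((s i * s j) ^+ k)^-1 * s j * (s i * s j) ^+ k
                * ((s i * s j) ^+ k)^-1 * (s i * s j * (s i * s j) ^+ k)).
    by rewrite mulgK !mulgA.
  by rewrite dihedral_conj -expgS expgSr !mulgA mulgVK expgSr !mulgA.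
exact: dihedral_conj.
Qed.

(* The reflections along a relator have period [m i j], so each occurs twice. *)
Lemma crosses_relator i j t : crosses (alternating i j (m i j).*2) t = false.
Proof.
have := wprod_relator i j; rewrite wprod_alternating_double => period.
rewrite /crosses right_reflections_alternating_double count_rev -addnn /mkseq.
rewrite iotaD map_cat count_cat add0n -{2}(addn0 (m i j)) iotaDl -map_comp.
rewrite (@eq_map _ _ (_ \o _) (fun q => s j * (s i * s j) ^+ q)) => [|q /=].
  by rewrite addnn odd_double.
by rewrite expgnDr period mul1g.
Qed.

Lemma crosses_wprod u v t : wp u = wp v -> crosses u t = crosses v t.
Proof.
move/wprod_eqP => uv; elim: uv t => // [x y z _ IH _ IH' t|x y i j t].
  by rewrite IH.
rewrite -alternating_double !crosses_cat !wprod_cat wprod_relator mul1g.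
by rewrite crosses_relator addFb.
Qed.

Lemma crosses_palindrome u i :
  crosses (u ++ i :: rev u) (wp u * s i * (wp u)^-1).
Proof.
set t := _ * _ * _.
rewrite -cat1s !crosses_cat wprod_cat wprod_rev wprod1 invgM invgK genV.
have -> : s i * (wp u)^-1 * t * (wp u * s i) = s i.
  by rewrite /t !mulgA mulgVK mulgVK -mulgA gen_sq mulg1.
have -> : (wp u)^-1 * t * wp u = s i by rewrite /t !mulgA mulVg mul1g mulgVK.
have : crosses (rev u ++ u) (s i) = false.
  by rewrite (@crosses_wprod _ [::]) // wprod_cat wprod_rev mulVg wprod_nil.
have -> : crosses [:: i] (s i).
  by rewrite /crosses /= wprod_nil invg1 mul1g mulg1 eqxx.
rewrite crosses_cat -/t.
by case: crosses; case: crosses.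
Qed.

Lemma crosses_mul_reflection u v t : reflection t -> wp v = wp u * t ->
  crosses v t = ~~ crosses u t.
Proof.
case=> x [i Et] Ev; have [a Ea _] := reduced_word x.
rewrite (@crosses_wprod _ (u ++ (a ++ i :: rev a))).
  rewrite crosses_cat wprod_cat wprod_cons wprod_rev mulgA Ea -Et mulgK.
  by rewrite Et -Ea crosses_palindrome addbT.
by rewrite Ev Et wprod_cat wprod_cat wprod_cons wprod_rev Ea !mulgA.
Qed.

Lemma strong_exchange u t : reflection t -> (ell (wp u * t) < ell (wp u))%N ->
  exists u1 i u2, u = u1 ++ i :: u2 /\ wp u * t = wp (u1 ++ u2).
Proof.
move=> rt lt; apply: right_reflections_delete; apply: crosses_mem.
apply: contraLR lt => not_crossed.
have [v Ev sv] := reduced_word (wp u * t).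
have := crosses_mul_reflection rt Ev.
rewrite not_crossed => /crosses_mem/ell_right_reflections.
by rewrite Ev -mulgA reflection_sq // mulg1 sv -leqNgt => /ltnW.
Qed.

Lemma exchange u i : (ell (wp u * s i) < ell (wp u))%N ->
  exists u1 j u2, u = u1 ++ j :: u2 /\ wp u * s i = wp (u1 ++ u2).
Proof. exact: strong_exchange (reflection_gen i). Qed.

Lemma bruhat_trans x y w : bruhat x y -> bruhat y w -> bruhat x w.
Proof. by move=> xy; elim=> // z t _ IH rt lt; apply: bruhat_step. Qed.

Lemma bruhat_ell x y : bruhat x y -> (ell x <= ell y)%N.
Proof. by elim=> // w t _ le_xw _ /ltnW; apply: leq_trans. Qed.

Lemma bruhat_subword (v w : coxeter m) : bruhat v w ->
  forall u, wp u = w -> exists2 u', subseq u' u & wp u' = v.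
Proof.
elim=> [u <-|{}w t _ IH rt lt u Eu]; first by exists u.
have [|u1 [i [u2 [Eu' del]]]] := @strong_exchange u t rt.
  by rewrite Eu -mulgA reflection_sq // mulg1.
rewrite Eu -mulgA reflection_sq // mulg1 in del.
have [u' su <-] := IH _ (esym del); exists u' => //.
rewrite Eu'; apply: subseq_trans su _; apply: cat_subseq => //.
exact: subseq_cons.
Qed.

Lemma bruhat_gen_ascent w i : (ell w < ell (w * s i))%N -> bruhat w (w * s i).
Proof. by apply: bruhat_step; [apply: bruhat_refl | apply: reflection_gen]. Qed.

Lemma bruhat_reflection_descent w t : reflection t -> (ell (w * t) < ell w)%N ->
  bruhat (w * t) w.
Proof.
move=> rt lt; have wK : w * t * t = w by rewrite -mulgA reflection_sq // mulg1.
rewrite -{2}wK; apply: bruhat_step; rewrite ?wK //.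
exact: bruhat_refl.
Qed.

Lemma bruhat_mul_gen_step w t i : reflection t -> (ell w < ell (w * t))%N ->
  bruhat (w * s i) (w * t) \/ bruhat (w * s i) (w * t * s i).
Proof.
move=> rt lt.
have [ti|ti] := eqVneq t (s i); first by left; rewrite ti; apply: bruhat_refl.
have [up|down] := ell_mul_gen w i; last first.
  left; apply: (@bruhat_trans _ w); last exact: bruhat_step (bruhat_refl _) rt lt.
  by apply: bruhat_reflection_descent; [apply: reflection_gen | rewrite down].
have rt' : reflection (s i * t * s i) by rewrite -{2}genV; apply: reflection_conj.
right; have -> : w * t * s i = w * s i * (s i * t * s i).
  by rewrite !mulgA mulg_genK.
apply: bruhat_step => //; first exact: bruhat_refl.
have := ell_mul_reflection_neq (w * s i) rt'; rewrite neq_ltn => /orP[|//].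
have [u Eu su] := reduced_word w.
rewrite -{1 2 4}Eu -wprod_rcons => /(strong_exchange rt')[u1 [j [u2 [Eur]]]].
rewrite wprod_rcons !mulgA mulg_genK Eu.
case/lastP: u2 Eur => [|u2 k] Eur Ew.
  move: Eur; rewrite cats1 => /rcons_inj[Eu1 _].
  move: Ew; rewrite cats0 -Eu1 Eu -{2}(mulg_genK w i).
  by move=> /mulIg/mulgI/eqP; rewrite (negPf ti).
move: Eur; rewrite -rcons_cons -rcons_cat => /rcons_inj[Eu1 Ek].
move: Ew; rewrite -rcons_cat wprod_rcons -Ek => /mulIg Ew.
have := ell_wprod (u1 ++ u2); rewrite -Ew => le.
by have := leq_trans lt le; rewrite -su Eu1 !size_cat /=; lia.
Qed.

Lemma bruhat_mul_gen (v w : coxeter m) i : bruhat v w ->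
  bruhat (v * s i) w \/ bruhat (v * s i) (w * s i).
Proof.
elim=> [|{}w t vw [le|le] rt lt]; first by right; apply: bruhat_refl.
  by left; apply: bruhat_step.
by have [le'|le'] := bruhat_mul_gen_step i rt lt; [left|right];
  apply: bruhat_trans le le'.
Qed.

Lemma subword_bruhat u u' : subseq u' u -> reduced u -> bruhat (wp u') (wp u).
Proof.
elim/last_ind: u u' => [|u i IH] u'.
  by rewrite subseq0 => /eqP-> _; apply: bruhat_refl.
move=> su red; have redu : reduced u.
  by apply: (@reduced_catl u [:: i]); rewrite cats1.
have up : bruhat (wp u) (wp (rcons u i)).
  rewrite wprod_rcons; apply: bruhat_gen_ascent.
  by rewrite -wprod_rcons -red -redu size_rcons.
case/lastP: u' su => [|u' j].
  by move=> _; apply: bruhat_trans up; apply: IH => //; apply: sub0seq.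
rewrite -subseq_rev !rev_rcons /=; case: eqP => [->|_] su.
  rewrite !wprod_rcons; have := IH u'; rewrite -subseq_rev.
  move=> /(_ su redu)/(bruhat_mul_gen i)[] // le.
  by apply: bruhat_trans le _; rewrite -wprod_rcons.
apply: bruhat_trans up; apply: IH => //.
by rewrite -subseq_rev rev_rcons.
Qed.

Implicit Types J K : pred I.

Lemma parabolic_wprod J u : all J u -> parabolic J (wp u).
Proof. by exists u. Qed.

Lemma parabolic1 J : parabolic J (1 : coxeter m).
Proof. by exists [::]; rewrite ?wprod_nil. Qed.

Lemma parabolicM J x y : parabolic J x -> parabolic J y -> parabolic J (x * y).
Proof.
by case=> u Ju <- [v Jv <-]; exists (u ++ v); rewrite ?all_cat ?Ju // wprod_cat.
Qed.

Lemma parabolicV J x : parabolic J x -> parabolic J x^-1.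
Proof. by case=> u Ju <-; exists (rev u); rewrite ?all_rev // wprod_rev. Qed.

Lemma parabolic_gen J i : J i -> parabolic J (s i).
Proof. by move=> Ji; exists [:: i]; rewrite /= ?Ji // wprod1. Qed.

Lemma bruhat_parabolic J (v w : coxeter m) : parabolic J w -> bruhat v w ->
  parabolic J v.
Proof.
case=> u Ju Eu vw; have [u' su <-] := bruhat_subword vw Eu.
by apply: parabolic_wprod; apply/allP => k /(mem_subseq su)/(allP Ju).
Qed.

Lemma min_rep1 J : min_rep J (1 : coxeter m).
Proof. by move=> x _; rewrite ell1. Qed.

(* A word of minimal length among the words in J for x: deleting one of its
   letters would contradict its minimality, one of w that of w. *)
Lemma min_rep_parabolic_word J w x : min_rep J w -> parabolic J x ->
  exists u, [/\ all J u, wp u = x & ell (w * x) = (ell w + size u)%N].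
Proof.
move=> minw [u0 Ju0 <-].
have ex : exists k, `[< exists2 u, all J u /\ size u = k & wp u = wp u0 >].
  by exists (size u0); apply/asboolP; exists u0.
case: (ex_minnP ex) => k /asboolP[u [Ju su] Eu] mink; exists u; split=> //.
have {mink} minu v : all J v -> wp v = wp u -> (size u <= size v)%N.
  by move=> Jv Ev; rewrite su; apply: mink; apply/asboolP; exists v; rewrite ?Ev.
rewrite -Eu {ex k su Eu Ju0 u0}.
have [a Ea sa] := reduced_word w.
elim/last_ind: u Ju minu => [|u i IH]; first by rewrite wprod_nil mulg1 addn0.
rewrite all_rcons => /andP[Ji Ju] minu.
have {}IH : ell (w * wp u) = (ell w + size u)%N.
  apply: IH => // v Jv Ev; have := minu (rcons v i).
  by rewrite all_rcons Ji Jv !wprod_rcons Ev !size_rcons ltnS; apply.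
rewrite wprod_rcons mulgA size_rcons addnS -IH.
have [//|down] := ell_mul_gen (w * wp u) i.
have [|a1 [j [a2 [Eau Ew]]]] := @exchange (a ++ u) i.
  by rewrite wprod_cat Ea down.
exfalso; move: Ew; rewrite wprod_cat Ea.
have [[a3 [Ea2 ->]]|[u1 [-> Eu]]] := cat_eq_cat_cons Eau; last first.
  rewrite -catA wprod_cat Ea -mulgA => /mulgI del_u.
  have := minu (u1 ++ a2); move: Ju; rewrite Eu !all_cat /= => /and3P[-> _ ->].
  rewrite wprod_rcons -Eu del_u => /(_ isT erefl).
  by rewrite Eu size_rcons !size_cat /=; lia.
rewrite catA wprod_cat => del_a.
have Jy : parabolic J (wp u * s i * (wp u)^-1).
  apply: parabolicM; last exact/parabolicV/parabolic_wprod.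
  by apply: parabolicM; [apply: parabolic_wprod | apply: parabolic_gen].
have := minw _ Jy; rewrite !mulgA del_a mulgK -sa leqNgt => /negP; apply.
by apply: leq_ltn_trans (ell_wprod _) _; rewrite Ea2 !size_cat /= addnS.
Qed.

Lemma parabolic_reduced_word J x : parabolic J x ->
  exists u, [/\ all J u, wp u = x & size u = ell x].
Proof.
case/(min_rep_parabolic_word (@min_rep1 J)) => u [Ju Eu len].
by exists u; split=> //; rewrite mul1g ell1 in len.
Qed.

Lemma ell_min_repM J w x : min_rep J w -> parabolic J x ->
  ell (w * x) = (ell w + ell x)%N.
Proof.
move=> minw Jx; have [u [Ju Eu len]] := min_rep_parabolic_word minw Jx.
apply/eqP; rewrite eqn_leq ellM len leq_add2l /=.
by rewrite -Eu ell_wprod.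
Qed.

Lemma min_rep_factor J w : exists (u x : coxeter m),
  [/\ min_rep J u, parabolic J x & w = u * x].
Proof.
have ex : exists k, `[< exists2 x, parabolic J x & ell (w * x) = k >].
  by exists (ell (w * 1)); apply/asboolP; exists 1 => //; apply: parabolic1.
case: (ex_minnP ex) => k /asboolP[x Jx <-] mink.
exists (w * x), x^-1; split; [|exact: parabolicV|by rewrite mulgK].
move=> y Jy; apply: mink; apply/asboolP; exists (x * y); first exact: parabolicM.
by rewrite mulgA.
Qed.

Lemma min_rep_coset_inj J w x : min_rep J w -> min_rep J (w * x) ->
  parabolic J x -> x = 1.
Proof.
move=> mw mwx Jx; have := mwx _ (parabolicV Jx).
by rewrite mulgK (ell_min_repM mw Jx) => le; apply: ell_eq0; lia.
Qed.

Lemma min_rep_factor_uniq J (u u' x x' : coxeter m) :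
  min_rep J u -> min_rep J u' -> parabolic J x -> parabolic J x' ->
  u * x = u' * x' -> u = u' /\ x = x'.
Proof.
move=> mu mu' Jx Jx' eq_ux.
have Eu' : u' = u * (x * x'^-1) by rewrite mulgA eq_ux mulgK.
have xx'1 : x * x'^-1 = 1.
  apply: (min_rep_coset_inj mu); first by rewrite -Eu'.
  by apply: parabolicM Jx (parabolicV Jx').
by split; [rewrite Eu' xx'1 mulg1 | rewrite -[x](mulgVK x') xx'1 mul1g].
Qed.

Lemma min_rep_ascent J w i : min_rep J w -> J i -> (ell w < ell (w * s i))%N.
Proof.
by move=> mw Ji; rewrite (ell_min_repM mw (parabolic_gen Ji)) ell_gen addn1.
Qed.

Lemma min_rep_of_ascents J w :
  (forall i, J i -> (ell w < ell (w * s i))%N) -> min_rep J w.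
Proof.
move=> up; have [u [x [mu Jx Ew]]] := min_rep_factor J w.
have [a [Ja Ea sa]] := parabolic_reduced_word Jx.
case/lastP: a Ja Ea sa => [|a i] Ja Ea sa; first by rewrite Ew -Ea wprod_nil mulg1.
move: Ja; rewrite all_rcons => /andP[Ji Ja].
have := up i Ji; rewrite {1}Ew (ell_min_repM mu Jx) Ew -Ea wprod_rcons mulgA mulg_genK.
rewrite (ell_min_repM mu (parabolic_wprod Ja)).
by rewrite -wprod_rcons Ea -sa size_rcons; have := ell_wprod a; lia.
Qed.

Lemma min_rep_right_factor J x y : min_rep J (x * y) ->
  ell (x * y) = (ell x + ell y)%N -> min_rep J y.
Proof.
move=> mxy len z Jz; have := mxy z Jz; rewrite -mulgA len.
by move=> le; have := leq_trans le (ellM x (y * z)); rewrite leq_add2l.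
Qed.

Lemma min_rep_reduced_tail J i u : reduced (i :: u) -> min_rep J (wp (i :: u)) ->
  min_rep J (wp u).
Proof.
move=> red; rewrite wprod_cons => mw; apply: min_rep_right_factor mw _.
by rewrite -wprod_cons -red ell_gen -(reduced_catr (u := [:: i]) red).
Qed.

Lemma bruhat_coset J w x : min_rep J w -> parabolic J x -> bruhat w (w * x).
Proof.
move=> mw Jx; have [a Ea sa] := reduced_word w.
have [b Eb sb] := reduced_word x.
rewrite -Ea -Eb -wprod_cat; apply: subword_bruhat; first exact: prefix_subseq.
by rewrite /reduced size_cat wprod_cat Ea Eb (ell_min_repM mw Jx) sa sb.
Qed.

Lemma bruhat_min_rep_coset J (v w x : coxeter m) : min_rep J v -> min_rep J w ->
  parabolic J x ->
  bruhat v (w * x) -> bruhat v w.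
Proof.
move=> mv mw Jx vwx; have [a Ea sa] := reduced_word w; have [b Jb Eb] := Jx.
have Ewx : wp (a ++ b) = w * x by rewrite wprod_cat Ea Eb.
have [c /subseq_cat_split[c1 [c2 [sub1 sub2 ->]]]] := bruhat_subword vwx Ewx.
rewrite wprod_cat => Ev; apply: (@bruhat_trans _ (wp c1)).
  have -> : wp c1 = v * (wp c2)^-1 by rewrite -Ev mulgK.
  apply: bruhat_coset mv _; apply/parabolicV/parabolic_wprod.
  by apply/allP => k /(mem_subseq sub2)/(allP Jb).
by rewrite -Ea; apply: subword_bruhat; rewrite // /reduced Ea.
Qed.

Lemma bruhat_reflected_coset J (v w x t : coxeter m) : min_rep J v -> min_rep J w ->
  parabolic J x -> reflection t -> t * w = v * x -> (ell v < ell w)%N -> bruhat v w.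
Proof.
move=> mv mw Jx rt Etw lt; have rt' := reflection_conj w^-1 rt.
have Evx : v * x = w * (w^-1 * t * w^-1^-1) by rewrite -Etw invgK !mulgA mulgV mul1g.
have := ell_mul_reflection_neq w rt'; rewrite neq_ltn => /orP[down|up].
  apply: bruhat_trans (bruhat_coset mv Jx) _; rewrite Evx.
  exact: bruhat_reflection_descent.
have : bruhat w (v * x) by rewrite Evx; apply: bruhat_step; [apply: bruhat_refl| |].
by move/(bruhat_min_rep_coset mw mv Jx)/bruhat_ell; rewrite leqNgt lt.
Qed.

Lemma reduced_word_support K u : injective s -> parabolic K (wp u) ->
  reduced u -> all K u.
Proof.
move=> inj Ku red; apply/allP => i iu.
have le_iu : bruhat (wp [:: i]) (wp u) by apply: subword_bruhat; rewrite ?sub1seq.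
have := bruhat_parabolic Ku le_iu; rewrite wprod1.
case/parabolic_reduced_word=> [[|k [|l b]]] [Kb Eb sb]; rewrite ell_gen in sb => //.
by move: Kb; rewrite /= andbT -(inj k i) // -Eb wprod1.
Qed.

(* If [s i] moves the coset of w upwards, then exchange leaves no room for
   [s i * w] to have a descent in J, unless [s i * w = w * s j]. *)
Lemma min_rep_gen_mul J w i : min_rep J w -> (ell w < ell (s i * w))%N ->
  (forall j, J j -> s i * w <> w * s j) -> min_rep J (s i * w).
Proof.
move=> mw up ne; apply: min_rep_of_ascents => j Jj; rewrite ltnNge; apply/negP => le.
have [u Eu su] := reduced_word w.
have := @exchange (i :: u) j; rewrite wprod_cons Eu.
case=> [|[|k u1] [l [u2 /= [[Ek Eu'] del]]]].
- by have [del|->//] := ell_mul_gen (s i * w) j; rewrite del ltnn in le.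
- by apply: (ne j Jj); rewrite -(mulg_genK (s i * w) j) del -Eu' Eu.
move: del; rewrite -Ek wprod_cons -mulgA => /mulgI del.
have := min_rep_ascent mw Jj; rewrite del -su Eu' !size_cat /=.
by have := ell_wprod (u1 ++ u2); rewrite size_cat; lia.
Qed.

Lemma reduced_dihedral_word i j a : all (pred2 i j) a -> reduced a ->
  a = alternating i j (size a) \/ a = alternating j i (size a).
Proof.
elim: a => [|k a IH] /=; first by left.
case/andP=> Jk Ja red; have neq_head b : a <> k :: b.
  move=> Ea; move: red (ell_wprod b); rewrite /reduced Ea !wprod_cons gen_mulgK /=.
  by move=> <-; rewrite ltnNge leqnSn.
have := IH Ja (reduced_catr (u := [:: k]) red).
case: a neq_head {IH Ja red} => [_ _|l a neq_head] /=.
  by case/orP: Jk => /eqP->; [left | right].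
case/orP: Jk neq_head => /eqP-> /(_ a) ne [] [El Ea]; rewrite El in ne *.
- by case: ne.
- by left; rewrite -Ea.
- by right; rewrite -Ea.
- by case: ne.
Qed.

(* By the braid relation an alternating word of length at least [m i j] can be
   made to start with either letter. *)
Lemma dihedral_ascent_word i j a : (0 < m i j)%N -> all (pred2 i j) a ->
  reduced a -> (ell (wp a) < ell (s i * wp a))%N ->
  a = alternating j i (size a) /\ (size a < m i j)%N.
Proof.
move=> m_gt0 Ja red up.
have long b : wp a = wp (i :: b) -> (size a <= size b)%N.
  move=> Ea; move: up; rewrite -red Ea wprod_cons gen_mulgK => up.
  exact: leq_trans (ltnW up) (ell_wprod b).
split.
  have [Ea|//] := reduced_dihedral_word Ja red.
  case: a Ea long {Ja red up} => //= k a [-> _] /(_ a erefl).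
  by rewrite ltnn.
rewrite ltnNge; apply/negP => le.
have [Ea|Ea] := reduced_dihedral_word Ja red.
  case: a Ea long le {Ja red up} => [|k a] /=; first by rewrite leqNgt m_gt0.
  by case=> -> _ /(_ a erefl); rewrite ltnn.
rewrite -(subnKC le) alternatingD in Ea; move: Ea.
set b := (if _ then _ else _) => Ea; have sb : size b = (size a - m i j)%N.
  by rewrite /b; case: odd; rewrite size_alternating.
suff /long : wp a = wp (i :: alternating j i (m i j).-1 ++ b).
  by rewrite size_cat size_alternating sb; lia.
rewrite [in LHS]Ea wprod_cat -wprod_braid -wprod_cat -cat_cons.
by rewrite -[in LHS](prednK m_gt0).
Qed.

End CoxeterGroups.

(** * The numbers game *)

(* The integers [wall i x] play the numbers game of Mozes: firing node i, which
   applies the generator i, changes [wall k] by [coef k i] times [wall i]. *)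
Record numbers_game (I : choiceType) (m : coxmat I) (X : Type)
    (act : I -> X -> X) (wall : I -> X -> int) (coef : I -> I -> int) : Prop :=
  NumbersGame {
  game_act_relator : forall i j x, iter (m i j) (act i \o act j) x = x;
  game_wall_act : forall k i x,
    wall k (act i x) = (wall k x + coef k i * wall i x)%R;
  game_act_fixed : forall i x, wall i x = 0%R -> act i x = x;
  game_coef_diag : forall i, coef i i = (- 2%:Z)%R;
  game_coef_bond : forall i j, i != j ->
    [\/ [/\ m i j = 2, coef i j = 0%R & coef j i = 0%R],
        [/\ m i j = 3, coef i j = 1%R & coef j i = 1%R] |
        [/\ m i j = 4, (0 < coef i j)%R, (0 < coef j i)%R &
            (coef i j * coef j i = 2%:Z)%R]] }.

Section NumbersGame.
Import Order.TTheory GRing.Theory Num.Theory.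
Local Open Scope group_scope.
Variables (I : choiceType) (m : coxmat I) (X : Type).
Variables (act : I -> X -> X) (wall : I -> X -> int) (coef : I -> I -> int).
Hypothesis game : numbers_game m act wall coef.
Implicit Types (u v a : seq I) (w t : coxeter m) (x : X) (i j : I).
Local Notation s := (gen m).
Local Notation wp := (wprod m).

Lemma foldr_act_wprod u v x : wp u = wp v -> foldr act x u = foldr act x v.
Proof.
move/wprod_eqP => uv; elim: uv x => // [a b d _ IH1 _ IH2 x|a b i j x].
  by rewrite IH1.
rewrite !foldr_cat; congr foldr; rewrite -[RHS](game_act_relator game i j).
by elim: (m i j) => //= k ->.
Qed.

Definition cox_act w x := foldr act x (repr w).

Lemma cox_act_wprod u x : cox_act (wp u) x = foldr act x u.
Proof. by apply: foldr_act_wprod; rewrite wprodE cox_class_repr. Qed.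

Lemma cox_actM (w w' : coxeter m) x : cox_act (w * w') x = cox_act w (cox_act w' x).
Proof.
have [u <- _] := reduced_word w; have [v <- _] := reduced_word w'.
by rewrite -wprod_cat !cox_act_wprod foldr_cat.
Qed.

Lemma cox_act1 x : cox_act 1 x = x.
Proof. by rewrite -(wprod_nil m) cox_act_wprod. Qed.

Lemma cox_actV (w w' : coxeter m) x : cox_act w x = cox_act w' x ->
  cox_act (w^-1 * w') x = x.
Proof. by move=> eq_x; rewrite cox_actM -eq_x -cox_actM mulVg cox_act1. Qed.

Lemma cox_act_gen i x : cox_act (s i) x = act i x.
Proof. by rewrite -wprod1 cox_act_wprod. Qed.

Lemma wall_act_self i x : wall i (act i x) = (- wall i x)%R.
Proof. by rewrite (game_wall_act game) (game_coef_diag game); ring. Qed.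

Lemma coef_ge0 i j : i != j -> (0 <= coef i j)%R.
Proof. by case/(game_coef_bond game) => [[_ -> _]|[_ -> _]|[_ /ltW]]. Qed.

Lemma bond_gt0 i j : i != j -> 0 < m i j.
Proof. by case/(game_coef_bond game) => [[->]|[->]|[->]]. Qed.

Section PositiveCone.
Variable P : int -> Prop.
Hypothesis P_add : forall y z, P y -> P z -> P (y + z)%R.

Lemma cone_muladd (k y z : int) : P y -> P z -> (0 <= k)%R -> P (y + k * z)%R.
Proof.
case: k => // k Py Pz _; elim: k => [|k IH]; first by rewrite mul0r addr0.
have -> : (y + k.+1%:Z * z = y + k%:Z * z + z)%R by lia.
exact: P_add.
Qed.

(* A form on the dihedral orbit is a nonnegative combination of the two walls
   as long as the word is shorter than the longest one. *)
Lemma wall_alternating i j k x : i != j -> k < m i j ->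
  P (wall i x) -> P (wall j x) -> P (wall i (foldr act x (alternating j i k))).
Proof.
move=> ij lt Pi Pj; have wallE := (game_wall_act game, game_coef_diag game).
have two : wall i (act j (act i x)) =
    ((coef i j * coef j i - 1) * wall i x + coef i j * wall j x)%R.
  by rewrite !wallE; ring.
case: k lt => [|[|k]] //=.
  by move=> _; rewrite wallE; apply: cone_muladd (coef_ge0 ij).
case: (game_coef_bond game ij) => [[-> _ _]|[-> cij cji]|[-> cij _ cc]] //.
  case: k => //= _; rewrite two cij cji mulr1 subrr mul0r add0r mul1r.
  exact: Pj.
case: k => [|[|k]] //= _.
  rewrite two cc (_ : 2%:Z - 1 = 1)%R // mul1r.
  exact: cone_muladd (ltW cij).
suff -> : wall i (act j (act i (act j x))) = wall i x by [].
rewrite !wallE; transitivity ((coef i j * coef j i - 1) * wall i x +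
  (coef i j * coef j i - 2%:Z) * coef i j * wall j x)%R; first by ring.
by rewrite cc; ring.
Qed.

Lemma wall_dihedral i j a x : i != j -> all (pred2 i j) a ->
  reduced m a -> (ell (wp a) < ell (s i * wp a))%N ->
  P (wall i x) -> P (wall j x) -> P (wall i (foldr act x a)).
Proof.
move=> ij Ja red up Pi Pj.
have [Ea lt] := dihedral_ascent_word (bond_gt0 ij) Ja red up; rewrite Ea.
exact: wall_alternating.
Qed.

(* Split off the factor of w in the dihedral group of a pair of generators one
   of which is a descent; the rest is shorter and has neither as a descent. *)
Lemma wall_ascent_cone x : (forall i, P (wall i x)) ->
  forall w i, (ell w < ell (s i * w))%N -> P (wall i (cox_act w x)).
Proof.
move=> Px w; have [k] := ubnP (ell w); elim: k w => // k IH w; rewrite ltnS => lek i up.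
have [[|j a] Ew sw] := reduced_word w.
  by rewrite -Ew wprod_nil cox_act1.
have lt : (ell (s j * w) < ell w)%N.
  by rewrite -sw -Ew wprod_cons gen_mulgK ltnS ell_wprod.
have ij : i != j by apply: contraTN up => /eqP->; rewrite -leqNgt ltnW.
have [v [y [mv Jy Evy]]] := min_rep_factor (pred2 i j) w^-1.
have [b [Jb Eb sb]] := parabolic_reduced_word (parabolicV Jy).
have Ewbv : w = wp b * v^-1 by rewrite Eb -invgM -Evy invgK.
have ell_factor z : parabolic (pred2 i j) z -> ell (z * v^-1) = (ell z + ell v)%N.
  move=> Jz; rewrite -ell_inv invgM invgK (ell_min_repM mv (parabolicV Jz)).
  by rewrite ell_inv addnC.
have Pb := parabolic_wprod m Jb.
have Ji : parabolic (pred2 i j) (s i) by apply: parabolic_gen; rewrite /= eqxx.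
have Jj : parabolic (pred2 i j) (s j) by apply: parabolic_gen; rewrite /= eqxx orbT.
have ellw : ell w = (ell (wp b) + ell v)%N by rewrite Ewbv ell_factor.
have ellsw r : parabolic (pred2 i j) (s r) ->
    ell (s r * w) = (ell (s r * wp b) + ell v)%N.
  by move=> Jr; rewrite Ewbv mulgA ell_factor //; apply: parabolicM.
have b_gt0 : 0 < ell (wp b) by have := ellsw j Jj; lia.
have IHv r : parabolic (pred2 i j) (s r) -> P (wall r (cox_act v^-1 x)).
  move=> Jr; apply: IH; first by rewrite ell_inv; lia.
  by rewrite ell_factor // ell_gen ell_inv.
rewrite Ewbv cox_actM cox_act_wprod; apply: (@wall_dihedral i j) => //.
- by rewrite /reduced sb Eb.
- by have := ellsw i Ji; lia.
- exact: IHv.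
- exact: IHv.
Qed.

End PositiveCone.

Lemma wall_ascent_ge0 x : (forall i, 0 <= wall i x)%R ->
  forall w i, (ell w < ell (s i * w))%N -> (0 <= wall i (cox_act w x))%R.
Proof.
move=> x_ge0 w i.
by apply: (@wall_ascent_cone (fun z => 0 <= z)%R) => // y z; apply: addr_ge0.
Qed.

Lemma wall_descent_le0 x : (forall i, 0 <= wall i x)%R ->
  forall w i, (ell (s i * w) < ell w)%N -> (wall i (cox_act w x) <= 0)%R.
Proof.
move=> x_ge0 w i lt; have := @wall_ascent_ge0 x x_ge0 (s i * w) i.
rewrite gen_mulgK => /(_ lt).
by rewrite cox_actM cox_act_gen wall_act_self oppr_ge0.
Qed.

Lemma wall_regular x : (forall i, 0 < wall i x)%R ->
  forall w i, (0 < wall i (cox_act w x))%R = (ell w < ell (s i * w))%N.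
Proof.
move=> x_gt0 w i; apply/idP/idP => [|lt]; last first.
  by apply: (@wall_ascent_cone (fun z => 0 < z)%R) => // y z; apply: addr_gt0.
case: (ell_gen_mul i w) => [->//|down].
have := wall_descent_le0 (fun k => ltW (x_gt0 k)) (w := w) (i := i).
by rewrite down ltnS leqnn leNgt => /(_ isT)/negPf->.
Qed.

Lemma wall_regularV x : (forall i, 0 < wall i x)%R ->
  forall w i, (0 < wall i (cox_act w^-1%g x))%R = (ell w < ell (w * s i))%N.
Proof.
by move=> x_gt0 w i; rewrite wall_regular // -(ell_inv (w * s i)) invgM genV ell_inv.
Qed.

Lemma gen_inj x : (forall i, 0 < wall i x)%R -> injective s.
Proof.
move=> x_gt0 i j eq_s; apply/eqP; apply: contraT => ij.
have := congr1 (wall i) (congr1 (fun w => cox_act w x) eq_s).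
rewrite !cox_act_gen wall_act_self (game_wall_act game).
have := mulr_ge0 (coef_ge0 ij) (ltW (x_gt0 j)); have := x_gt0 i; lia.
Qed.

Section Vertex.
Variables (J : pred I) (x0 : X).
Hypothesis x0_ge0 : forall i, (0 <= wall i x0)%R.
Hypothesis x0_walls : forall i, J i = (wall i x0 == 0%R).

Lemma cox_act_stab w : cox_act w x0 = x0 -> parabolic J w.
Proof.
have [k] := ubnP (ell w); elim: k w => // k IH w; rewrite ltnS => lek wx0.
have [[|i a] Ew sw] := reduced_word w; first by rewrite -Ew wprod_nil;
  apply: parabolic1.
have lt : (ell (s i * w) < ell w)%N.
  by rewrite -sw -Ew wprod_cons gen_mulgK ltnS ell_wprod.
have wall0 : wall i x0 = 0%R.
  apply/eqP; rewrite eq_le x0_ge0 andbT -{1}wx0.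
  exact: wall_descent_le0.
rewrite -(gen_mulgK w i); apply: parabolicM.
  by apply: parabolic_gen; rewrite x0_walls; apply/eqP.
apply: IH; first exact: leq_trans lt lek.
by rewrite cox_actM wx0 cox_act_gen (game_act_fixed game).
Qed.

Lemma min_rep_vertex_inj (w w' : coxeter m) : min_rep J w -> min_rep J w' ->
  cox_act w x0 = cox_act w' x0 -> w = w'.
Proof.
move=> mw mw' /cox_actV/cox_act_stab Jz.
have Ew' : w' = w * (w^-1 * w') by rewrite mulgA mulgV mul1g.
by rewrite Ew' (min_rep_coset_inj mw _ Jz) ?mulg1 // -Ew'.
Qed.

Lemma min_rep_fire w i : min_rep J w -> (0 < wall i (cox_act w x0))%R ->
  min_rep J (s i * w) /\ ell (s i * w) = (ell w).+1.
Proof.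
move=> mw wall_gt0; case: (ell_gen_mul i w) => up; last first.
  have lt : (ell (s i * w) < ell w)%N by rewrite up.
  by have := wall_descent_le0 x0_ge0 lt; rewrite leNgt wall_gt0.
split=> //; apply: min_rep_gen_mul => // [|k Jk Es]; first by rewrite up.
have := congr1 (fun z => wall i (cox_act z x0)) Es.
rewrite !cox_actM !cox_act_gen (@game_act_fixed _ _ _ _ _ _ game k); last first.
  by apply/eqP; rewrite -x0_walls.
by rewrite wall_act_self; move: wall_gt0; lia.
Qed.

Lemma min_rep_fire_conv w i : min_rep J w -> min_rep J (s i * w) ->
  (ell w < ell (s i * w))%N -> (0 < wall i (cox_act w x0))%R.
Proof.
move=> mw msw lt; rewrite lt_neqAle (wall_ascent_ge0 x0_ge0 lt) andbT eq_sym.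
apply/eqP => wall0; have := @min_rep_vertex_inj (s i * w) w msw mw.
rewrite cox_actM cox_act_gen (game_act_fixed game wall0) => /(_ erefl) Esw.
by move: lt; rewrite Esw ltnn.
Qed.

Lemma min_rep_vertex w : exists2 v, min_rep J v & cox_act v x0 = cox_act w x0.
Proof.
have [v [x [mv [u Ju Eu] Ew]]] := min_rep_factor J w; exists v => //.
rewrite Ew cox_actM -Eu cox_act_wprod; congr cox_act; symmetry.
elim: u Ju {Eu} => //= i u IH /andP[Ji /IH->]; apply: (game_act_fixed game).
by apply/eqP; rewrite -x0_walls.
Qed.

Variable rank : X -> nat.
Hypothesis rank_vertex : rank x0 = 0.
Hypothesis rank_fire : forall i x, (0 < wall i x)%R -> rank (act i x) = (rank x).+1.

Lemma ell_rank w : min_rep J w -> ell w = rank (cox_act w x0).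
Proof.
have [u <- red] := reduced_word w; elim: u red => [|i u IH] red mw.
  by rewrite wprod_nil ell1 cox_act1 rank_vertex.
have mu := min_rep_reduced_tail red mw; have redu := reduced_catr (u := [:: i]) red.
have up := reduced_cons_lt red; rewrite -red /= redu (IH redu mu).
rewrite wprod_cons in mw *; rewrite cox_actM cox_act_gen rank_fire //.
exact: min_rep_fire_conv.
Qed.

Lemma bruhat_reflected_vertex w t : min_rep J w -> reflection t ->
  (rank (cox_act t (cox_act w x0)) < rank (cox_act w x0))%N ->
  exists v : coxeter m, [/\ min_rep J v, bruhat v w &
    cox_act v x0 = cox_act t (cox_act w x0)].
Proof.
rewrite -cox_actM => mw rt lt; have [v mv Ev] := min_rep_vertex (t * w).
exists v; split=> //; have Jx := cox_act_stab (cox_actV Ev).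
apply: (bruhat_reflected_coset mv mw Jx rt); first by rewrite mulgA mulgV mul1g.
by rewrite !ell_rank // Ev.
Qed.

End Vertex.

End NumbersGame.

(* Decides the conditionals of the goal by [lia], splitting on those it cannot. *)
Ltac decide_ifs := repeat match goal with
  | |- context [if ?b then _ else _] =>
    lazymatch b with context [if _ then _ else _] => fail | _ => idtac end;
    first [ have -> : b = true by lia | have -> : b = false by lia
          | case: (boolP b) => ? ]
  end.

(* Identifies [x a] and [x b] whenever [lia] proves [a = b]. *)
Ltac merge_args x := repeat match goal with
  | |- context [x ?a] => match goal with
    | |- context [x ?b] => lazymatch a with b => fail | _ => idtac end;
      have -> : x a = x b by (congr (x _); lia)
    end
  end.

(** * The affine group of type B acting on Z^n *)

Section AffineBAction.
Import Order.TTheory GRing.Theory Num.Theory.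
Local Open Scope ring_scope.
Variable n : nat.
Hypothesis n_ge3 : (2 < n)%N.
Implicit Types (N : int) (x : nat -> int) (i j k : nat).

(* The affine Weyl group acts on Z^n, with coordinates numbered from 0, by the
   reflections in the walls [point_wall N i] of an alcove dilated by N. *)
Definition point_act N i x : nat -> int := fun k =>
  if i == 0%N then
    (if k == 0%N then N - x 1%N else if k == 1%N then N - x 0%N else x k)
  else if (i < n)%N then
    (if k == i.-1 then x i else if k == i then x i.-1 else x k)
  else (if k == n.-1 then - x n.-1 else x k).

Definition point_wall N i x : int :=
  if i == 0%N then N - x 0%N - x 1%N
  else if (i < n)%N then x i.-1 - x i else x n.-1.

(* The entries of the Cartan matrix of type B, up to sign; the root of node n is
   the short one. *)
Definition point_coef k i : int :=
  if k == i then - 2%:Z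
  else let b := affB_bond n (minn k i) (maxn k i) in
    if b == 2%N then 0 else if (b == 4%N) && (i == n) then 2%:Z else 1.

Lemma point_wall_act N k i x : (k <= n)%N -> (i <= n)%N ->
  point_wall N k (point_act N i x) =
  point_wall N k x + point_coef k i * point_wall N i x.
Proof.
move=> kn inn; rewrite /point_coef /affB_bond.
have [->|ne] := eqVneq k i.
  by rewrite /point_wall /point_act; decide_ifs; merge_args x; lia.
have [lt|ge] := ltnP k i; rewrite /point_wall /point_act; decide_ifs;
  rewrite ?mul0r ?mul1r; merge_args x; lia.
Qed.

Lemma point_act_out N i x k : (i <= n)%N -> (n <= k)%N -> point_act N i x k = x k.
Proof. by move=> i_n nk; rewrite /point_act; decide_ifs. Qed.

Lemma point_act_fixed N i x : (i <= n)%N -> point_wall N i x = 0 ->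
  point_act N i x = x.
Proof.
move=> i_n; rewrite /point_wall => wall0; apply/funext => k; move: wall0.
rewrite /point_act; decide_ifs; move=> wall0; first [done | move: wall0;
  merge_args x; lia].
Qed.

Lemma point_eq_of_walls N (x y : nat -> int) :
  (forall i, (i <= n)%N -> point_wall N i x = point_wall N i y) ->
  (forall k, (n <= k)%N -> x k = y k) -> x = y.
Proof.
move=> wall_xy out_xy; apply/funext => k; have [|nk] := leqP n k; first exact: out_xy.
have [d] := ubnP (n - k)%N; elim: d k nk => // d IH k nk lt.
have := wall_xy k.+1; rewrite /point_wall /= => /(_ nk).
case: ltnP => [lt1|ge1 eq_last].
  have -> : x k.+1 = y k.+1 by apply: IH; lia.
  by move/addIr.
by have -> : k = n.-1 by lia.
Qed.

Definition node_act N (i : 'I_n.+1) x := point_act N i x.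
Definition node_wall N (i : 'I_n.+1) x := point_wall N i x.
Definition node_coef (k i : 'I_n.+1) := point_coef k i.

Lemma node_wall_act N (k i : 'I_n.+1) x :
  node_wall N k (node_act N i x) = node_wall N k x + node_coef k i * node_wall N i x.
Proof. by apply: point_wall_act; rewrite -ltnS. Qed.

Lemma node_coef_diag (i : 'I_n.+1) : node_coef i i = - 2%:Z.
Proof. by rewrite /node_coef /point_coef eqxx. Qed.

Lemma node_coef_bond (i j : 'I_n.+1) : i != j ->
  [\/ [/\ affB_mat n i j = 2, node_coef i j = 0 & node_coef j i = 0],
      [/\ affB_mat n i j = 3, node_coef i j = 1 & node_coef j i = 1] |
      [/\ affB_mat n i j = 4, 0 < node_coef i j, 0 < node_coef j i &
          node_coef i j * node_coef j i = 2%:Z]].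
Proof.
move=> ij; have ij' : (i : nat) != j by [].
rewrite /node_coef /point_coef /= /affB_m (negPf ij) (negPf ij').
rewrite [(j : nat) == i]eq_sym (negPf ij') (minnC j) (maxnC j) /affB_bond.
case: (i : nat) (ltn_ord i) ij' => {i ij} [|i] li;
case: (j : nat) (ltn_ord j) => {j} [|j] lj ij'; rewrite ?minn0 ?min0n ?maxn0 ?max0n;
decide_ifs; (try by constructor 1); (try by constructor 2);
by constructor 3; split => //; decide_ifs; lia.
Qed.

(* For a bond of order 4, the square of the product of the two reflections acts
   on the span of their walls as -1. *)
Lemma node_wall_relator N (i j k : 'I_n.+1) x :
  node_wall N k (iter (affB_mat n i j) (node_act N i \o node_act N j) x) =
  node_wall N k x.
Proof.
have [<-|ij] := eqVneq i j.
  by rewrite cox_diag /= !node_wall_act !node_coef_diag; ring.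
case: (node_coef_bond ij) => [[-> cij cji]|[-> cij cji]|[-> cij0 cji0 cc]] /=.
- by rewrite !node_wall_act ?cij ?cji !node_coef_diag; ring.
- by rewrite !node_wall_act ?cij ?cji !node_coef_diag; ring.
pose D y := node_act N i (node_act N j y).
have coefs : (node_coef i j = 1 /\ node_coef j i = 2%:Z) \/
             (node_coef i j = 2%:Z /\ node_coef j i = 1) by nia.
have opp_i y : node_wall N i (D (D y)) = - node_wall N i y.
  by rewrite /D !node_wall_act !node_coef_diag; case: coefs => [[-> ->]|[-> ->]]; ring.
have opp_j y : node_wall N j (D (D y)) = - node_wall N j y.
  by rewrite /D !node_wall_act !node_coef_diag; case: coefs => [[-> ->]|[-> ->]]; ring.
have [A [B span_k]] : exists A B, forall y, node_wall N k (D (D y)) =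
    node_wall N k y + A * node_wall N i y + B * node_wall N j y.
  pose a := node_coef k i; pose b := node_coef k j.
  have [[cij cji]|[cij cji]] := coefs.
    exists (2%:Z * a + 2%:Z * b), (2%:Z * b + a) => y.
    by rewrite /D !node_wall_act !node_coef_diag cij cji -/a -/b; ring.
  exists (2%:Z * a + b), (2%:Z * b + 2%:Z * a) => y.
  by rewrite /D !node_wall_act !node_coef_diag cij cji -/a -/b; ring.
by rewrite -!/(D _) !span_k opp_i opp_j; ring.
Qed.

Lemma node_act_relator N (i j : 'I_n.+1) x :
  iter (affB_mat n i j) (node_act N i \o node_act N j) x = x.
Proof.
apply: (@point_eq_of_walls N) => [k kn|k nk].
  exact: (node_wall_relator N i j (Ordinal (kn : k < n.+1)%N)).
elim: (affB_mat n i j) => //= r IH.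
by rewrite /node_act !point_act_out // -ltnS.
Qed.

Lemma affB_game N : numbers_game (affB_mat n) (node_act N) (node_wall N) node_coef.
Proof.
split; [exact: node_act_relator | exact: node_wall_act | | exact: node_coef_diag
  | exact: node_coef_bond].
by move=> i x; apply: point_act_fixed; rewrite -ltnS.
Qed.

End AffineBAction.

(** * Segments *)

Section Segments.
Import Order.TTheory GRing.Theory Num.Theory.
Local Open Scope ring_scope.
Implicit Types (N : int) (x y : nat -> int) (i j k : nat) (b : bool) (c : seq nat).

(* The symmetry of the alcove that exchanges the walls 0 and 1. *)
Definition flip N x : nat -> int := fun k => if k == 0%N then N - x 0%N else x k.

Lemma flipK N : involutive (flip N).
Proof. by move=> x; apply/funext => -[|k]; rewrite /flip //= opprB addrC subrK. Qed.

Definition twist N b x := if b then x else flip N x.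

Lemma twistK N b : involutive (twist N b).
Proof. by case: b => // x; apply: flipK. Qed.

Lemma twist_twistN N b x : twist N b (twist N (~~ b) x) = flip N x.
Proof. by case: b. Qed.

Definition flip_letter k : nat :=
  if k == 0%N then 1%N else if k == 1%N then 0%N else k.

Definition relabel b k : nat := if k == 1%N then b : nat else k.

Lemma relabelE b k : (0 < k)%N -> relabel b k = if b then k else flip_letter k.
Proof. by case: b; case: k => [|[|k]]. Qed.

Variable n : nat.
Hypothesis n_ge3 : (2 < n)%N.

Definition colored_word b c : seq 'I_n.+1 := [seq inord (relabel b k) | k <- c].

Lemma segmentE b j :
  segment n b j = wprod (affB_mat n) (colored_word b (segment_word n j)).
Proof. by []. Qed.

Lemma relabel_le b k : (0 < k <= n)%N -> (relabel b k <= n)%N.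
Proof. by rewrite /relabel; case: b => /=; decide_ifs; lia. Qed.

Lemma flip_point_act N k x : (k <= n)%N ->
  flip N (point_act n N k x) = point_act n N (flip_letter k) (flip N x).
Proof.
move=> lek; apply/funext => l; rewrite /point_act /flip /flip_letter.
by decide_ifs => //; merge_args x; lia.
Qed.

Lemma point_wall_flip N k x : (k <= n)%N ->
  point_wall n N (flip_letter k) (flip N x) = point_wall n N k x.
Proof.
move=> lek; rewrite /point_wall /flip /flip_letter.
by decide_ifs => //; merge_args x; lia.
Qed.

Lemma point_act_relabel N b x k : (0 < k <= n)%N ->
  point_act n N (relabel b k) x = twist N b (point_act n N k (twist N b x)).
Proof.
case/andP=> k0 lek; rewrite relabelE //; case: b => //=.
by rewrite flip_point_act // flipK.
Qed.

Lemma point_wall_relabel N b x k : (0 < k <= n)%N ->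
  point_wall n N (relabel b k) (twist N b x) = point_wall n N k x.
Proof. by case/andP=> k0 lek; rewrite relabelE //; case: b => //=;
  apply: point_wall_flip. Qed.

Lemma point_wall_twistN N b x :
  point_wall n N (~~ b) (twist N b x) = point_wall n N 0 x.
Proof. by case: b => //; apply: (@point_wall_flip N 0). Qed.

Lemma foldr_colored_word N b x c : all (fun k => 0 < k <= n)%N c ->
  foldr (@node_act n N) x (colored_word b c) =
  twist N b (foldr (point_act n N) (twist N b x) c).
Proof.
elim: c => [|k c IH] /=; first by rewrite twistK.
move=> /andP[lek /IH->]; rewrite /node_act inordK ?ltnS ?relabel_le //.
by rewrite point_act_relabel // twistK.
Qed.

Definition segment_letter j := (if j <= n then j else 2 * n - j)%N.

Lemma segment_wordS j : (j.+1 < 2 * n)%N ->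
  segment_word n j.+1 = segment_letter j.+1 :: segment_word n j.
Proof.
move=> lt; rewrite /segment_word /segment_letter.
have [le|gt] := leqP j.+1 n.
  by rewrite (ltnW le) -[in LHS](addn1 j) iotaD cats1 rev_rcons add1n.
have [le|gt'] := leqP j n.
  have -> : (j = n)%N by lia.
  by have -> : (n.+1 - n = 1)%N by lia.
have -> : (j.+1 - n = (j - n).+1)%N by lia.
by rewrite /=; have -> : ((2 * n - j.+1).+1 = 2 * n - j)%N by lia.
Qed.

Lemma segment_word_low j : (j <= n)%N -> segment_word n j = rev (iota 1 j).
Proof. by rewrite /segment_word => ->. Qed.

Lemma segment_letter_bounds j : (j.+1 < 2 * n)%N ->
  (0 < segment_letter j.+1 <= n)%N.
Proof. by rewrite /segment_letter; case: ifP; lia. Qed.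

Lemma size_segment_word j : (j < 2 * n)%N -> size (segment_word n j) = j.
Proof. by elim: j => // j IH lt; rewrite segment_wordS //= IH //; lia. Qed.

Lemma segment_word_bounds j : (j < 2 * n)%N ->
  all (fun k => 0 < k <= n)%N (segment_word n j).
Proof.
elim: j => // j IH lt.
by rewrite segment_wordS //= segment_letter_bounds // IH //; lia.
Qed.

Lemma segment_word_subseq i j : (i <= j)%N -> (j < 2 * n)%N ->
  subseq (segment_word n i) (segment_word n j).
Proof.
move=> lij ltj; rewrite -(subnKC lij) in ltj *.
elim: (j - i)%N ltj => [|k IH] lt; first by rewrite addn0.
rewrite addnS segment_wordS // -addnS //.
by apply: subseq_trans (subseq_cons _ _); apply: IH; lia.
Qed.

Definition segment_pos j := (if j < n then j else 2 * n - j.+1)%N.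

Lemma segment_act N j x : (j < 2 * n)%N ->
  foldr (point_act n N) x (segment_word n j) = fun k =>
    if (k < segment_pos j)%N then x k.+1
    else if k == segment_pos j then (if (j < n)%N then x 0%N else - x 0%N) else x k.
Proof.
elim: j => [|j IH] lt.
  by apply/funext => k; rewrite /segment_pos /=; decide_ifs => //; congr x; lia.
rewrite segment_wordS //= IH; last by lia.
apply/funext => k; rewrite /point_act /segment_letter /segment_pos.
by decide_ifs => //; merge_args x; lia.
Qed.

Lemma segment_act_rev N j x : (j < 2 * n)%N ->
  foldr (point_act n N) x (rev (segment_word n j)) = fun k =>
    if k == 0%N then (if (j < n)%N then x (segment_pos j) else - x (segment_pos j))
    else if (k <= segment_pos j)%N then x k.-1 else x k.
Proof.
elim: j x => [|j IH] x lt.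
  by apply/funext => k; rewrite /segment_pos /=; decide_ifs => //; congr x; lia.
rewrite segment_wordS // rev_cons foldr_rcons IH; last by lia.
apply/funext => k; rewrite /point_act /segment_letter /segment_pos.
by decide_ifs => //; merge_args x; lia.
Qed.

Definition origin : nat -> int := fun=> 0.

(* The vertex of the alcove that lies on all its walls except the wall b. *)
Definition base_vertex b := twist 1 (~~ b) origin.

Lemma segment_base_vertex b j : (j < 2 * n)%N ->
  foldr (@node_act n 1) (base_vertex b) (colored_word b (segment_word n j)) =
  twist 1 b (fun k => if k == segment_pos j then (if (j < n)%N then 1 else - 1) else 0).
Proof.
move=> lt; rewrite foldr_colored_word ?segment_word_bounds //
  twist_twistN segment_act //.
congr twist; apply/funext => k; rewrite /flip /origin /segment_pos.
by decide_ifs => //; lia.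
Qed.

Lemma segment_wall j k : (j < 2 * n)%N -> (0 < k <= n)%N ->
  (0 < point_wall n 1 k
         (fun k => if k == segment_pos j then (if (j < n)%N then 1 else - 1) else 0))
  = (j.+1 < 2 * n)%N && (k == segment_letter j.+1).
Proof.
by move=> lt lek; rewrite /point_wall /segment_pos /segment_letter; decide_ifs => //;
  lia.
Qed.

Definition part_rel i j := ((j < i) || ((i == j) && (n <= i)))%N.

Section DominantPoint.
Variables (N : int) (x : nat -> int).
Hypothesis x_dominant : forall k, (0 < k <= n)%N -> 0 < point_wall n N k x.

Lemma dominant_gt0 k : (k < n)%N -> 0 < x k.
Proof.
have [d] := ubnP (n - k)%N; elim: d k => // d IH k led lt.
have := x_dominant (k := k.+1); rewrite /point_wall /= lt => /(_ isT).
case: ltnP => [lt' |ge]; last by have -> : k = n.-1 by lia.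
move=> ?; have : 0 < x k.+1 by [apply: IH => //; lia]; lia.
Qed.

Lemma dominant_decreasing k l : (k < l < n)%N -> x l < x k.
Proof.
elim: l => // l IH /andP[lkl ltn].
have := x_dominant (k := l.+1); rewrite /point_wall /= ltn (ltnW ltn) => /(_ isT).
by have [->|ne] := eqVneq k l; [lia | have : x l < x k by [apply: IH; lia]; lia].
Qed.

Lemma dominant_segments_wall i j : (0 < i < 2 * n)%N -> (0 < j < 2 * n)%N ->
  let y := foldr (point_act n N) x (rev (segment_word n j)) in
  0 < N -> 0 < point_wall n N 0 y ->
  (0 < point_wall n N 0 (foldr (point_act n N) (flip N y) (rev (segment_word n i)))) =
  part_rel i j.
Proof.
move=> /andP[i0 lti] /andP[j0 ltj] /= N0; rewrite !segment_act_rev // /part_rel.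
set p := segment_pos i; set q := segment_pos j.
have pn : (p < n)%N by rewrite /p /segment_pos; case: (ltnP i n); lia.
have qn : (q < n)%N by rewrite /q /segment_pos; case: (ltnP j n); lia.
rewrite /point_wall /flip /=.
have [p0|p_gt0] := posnP p.
  have [Ei ni] : i = (2 * n).-1 /\ (i < n)%N = false.
    by move: p0; rewrite /p /segment_pos; case: (ltnP i n); lia.
  by rewrite ni /= => wall0; lia.
have xq := dominant_gt0 qn; have xp := dominant_gt0 pn.
have [lepq|ltqp] := leqP p q.
  have xpq : x q < x p.-1 by apply: dominant_decreasing; lia.
  move: lepq xq xpq; rewrite /p /q /segment_pos.
  by case: (ltnP i n); case: (ltnP j n) => /=; lia.
have xqp : x p < x q by apply: dominant_decreasing; rewrite ltqp.
move: ltqp xp xqp; rewrite /p /q /segment_pos.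
by case: (ltnP i n); case: (ltnP j n) => /=; lia.
Qed.

End DominantPoint.

End Segments.

(** * Shapes of minimal coset representatives *)

Section Factorization.
Local Open Scope ring_scope.
Variable n : nat.
Hypothesis n_ge3 : (2 < n)%N.
Implicit Types (b : bool) (u v w : affB n).
Local Notation s := (gen (affB_mat n)).
Local Notation wp := (wprod (affB_mat n)).

Definition affB_act N : affB n -> (nat -> int) -> nat -> int :=
  @cox_act _ (affB_mat n) _ (@node_act n N).

Lemma node_wall_base_vertex b (i : 'I_n.+1) :
  node_wall 1 i (base_vertex b) = ((i : nat) == b)%:R.
Proof.
rewrite /node_wall /base_vertex /twist /flip /origin /point_wall.
by case: b => /=; case: (i : nat) (ltn_ord i) => [|[|k]] //= lt; decide_ifs.
Qed.

Lemma base_vertex_ge0 b (i : 'I_n.+1) : 0 <= node_wall 1 i (base_vertex b).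
Proof. by rewrite node_wall_base_vertex; case: (nat_of_ord i == b). Qed.

Lemma omitE b (i : 'I_n.+1) : omit b i = (node_wall 1 i (base_vertex b) == 0).
Proof. by rewrite node_wall_base_vertex /omit; case: (nat_of_ord i == b). Qed.

Definition interior_point : nat -> int := fun k => (n - k)%N%:Z.

Lemma interior_point_wall (i : 'I_n.+1) : 0 < node_wall (2 * n)%N%:Z i interior_point.
Proof.
by rewrite /node_wall /interior_point /point_wall; have := ltn_ord i; decide_ifs; lia.
Qed.

Lemma ascent_wall w (i : 'I_n.+1) :
  (0 < node_wall (2 * n)%N%:Z i (affB_act (2 * n)%N%:Z w^-1%g interior_point)) =
  (ell w < ell (w * s i)%g)%N.
Proof. exact: (wall_regularV (affB_game n_ge3 _) interior_point_wall). Qed.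

Lemma affB_gen_inj : injective s.
Proof. exact: (gen_inj (affB_game n_ge3 _) interior_point_wall). Qed.

Lemma affB_act_wprod N (u : seq 'I_n.+1) x :
  affB_act N (wp u) x = foldr (@node_act n N) x u.
Proof. exact: (cox_act_wprod (affB_game n_ge3 N)). Qed.

Lemma affB_actM N u v x : affB_act N (u * v)%g x = affB_act N u (affB_act N v x).
Proof. exact: (cox_actM (affB_game n_ge3 N)). Qed.

Lemma affB_min_rep_fire b w (i : 'I_n.+1) : min_rep (omit b) w ->
  0 < node_wall 1 i (affB_act 1 w (base_vertex b)) ->
  min_rep (omit b) (s i * w)%g /\ ell (s i * w)%g = (ell w).+1.
Proof. exact: (min_rep_fire (affB_game n_ge3 1) (@base_vertex_ge0 b) (omitE b)). Qed.

Lemma affB_min_rep_fire_conv b w (i : 'I_n.+1) : min_rep (omit b) w ->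
  min_rep (omit b) (s i * w)%g ->
  (ell w < ell (s i * w)%g)%N -> 0 < node_wall 1 i (affB_act 1 w (base_vertex b)).
Proof. exact: (min_rep_fire_conv (affB_game n_ge3 1) (@base_vertex_ge0 b) (omitE b)). Qed.

Lemma affB_vertex_inj b w w' : min_rep (omit b) w -> min_rep (omit b) w' ->
  affB_act 1 w (base_vertex b) = affB_act 1 w' (base_vertex b) -> w = w'.
Proof. exact: (min_rep_vertex_inj (affB_game n_ge3 1) (@base_vertex_ge0 b) (omitE b)). Qed.

Lemma segmentS b j : (j.+1 < 2 * n)%N -> segment n b j.+1 =
  (s (inord (relabel b (segment_letter n j.+1))) * segment n b j)%g.
Proof. by move=> lt; rewrite !segmentE segment_wordS // wprod_cons. Qed.

Lemma node_wall_segment b j k : (j < 2 * n)%N -> (0 < k <= n)%N ->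
  (0 < node_wall 1 (inord (relabel b k) : 'I_n.+1)
         (affB_act 1 (segment n b j) (base_vertex b))) =
  (j.+1 < 2 * n)%N && (k == segment_letter n j.+1).
Proof.
move=> lt lek; rewrite segmentE affB_act_wprod segment_base_vertex //.
by rewrite /node_wall inordK ?ltnS ?relabel_le // point_wall_relabel // segment_wall.
Qed.

Lemma segment_min_rep b j : (j < 2 * n)%N ->
  min_rep (omit b) (segment n b j) /\ ell (segment n b j) = j.
Proof.
elim: j => [|j IH] lt.
  by rewrite segmentE wprod_nil ell1; split => //; apply: min_rep1.
have [mj ej] := IH (ltnW lt); rewrite segmentS // -[in RHS]ej;
  apply: affB_min_rep_fire mj _.
by rewrite node_wall_segment ?segment_letter_bounds ?lt ?eqxx // ltnW.
Qed.

Lemma segment_parabolic b j : (j < 2 * n)%N ->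
  parabolic (omit (~~ b)) (segment n b j).
Proof.
move=> lt; apply: parabolic_wprod; rewrite all_map.
apply/allP => k kin; have /= lek := allP (segment_word_bounds n_ge3 lt) k kin.
rewrite /omit inordK ?ltnS ?relabel_le // /relabel.
by case: b; case: k lek {kin} => [|[|k]].
Qed.

Lemma omit_relabel b k : (0 < k <= n)%N ->
  omit (~~ b) (inord (relabel b k) : 'I_n.+1).
Proof.
move=> lek; rewrite /omit inordK ?ltnS ?relabel_le // /relabel.
by case: b; case: k lek => [|[|k]].
Qed.

Lemma omit_relabel_ex b (i : 'I_n.+1) : omit (~~ b) i ->
  exists2 k, (0 < k <= n)%N & i = inord (relabel b k).
Proof.
rewrite /omit => ne; have lt := ltn_ord i; exists (if (i : nat) == b then 1 else i)%N.
  by case: b ne => /=; case: (nat_of_ord i) lt => [|[|k]] //=; lia.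
apply: val_inj; rewrite /= inordK /relabel.
  by case: b ne; case: (nat_of_ord i) lt => [|[|k]].
by case: b ne; case: (nat_of_ord i) lt => [|[|k]] //=; lia.
Qed.

Lemma parabolic_min_segment b v : min_rep (omit b) v -> parabolic (omit (~~ b)) v ->
  exists2 j, (j < 2 * n)%N & v = segment n b j.
Proof.
move=> mv /parabolic_reduced_word[a [Ja Ea red]]; rewrite -{}Ea in mv red *.
elim: a Ja mv red => [|i a IH] /=.
  by exists 0%N; [lia | rewrite segmentE].
case/andP=> oi Ja mv red; have up := reduced_cons_lt red.
have ma := min_rep_reduced_tail red mv.
have [j lt Ej] := IH Ja ma (reduced_catr (u := [:: i]) red).
have [k lek Ei] := omit_relabel_ex oi.
rewrite wprod_cons in mv *; have := affB_min_rep_fire_conv ma mv up.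
rewrite Ej Ei node_wall_segment // => /andP[lt' /eqP->].
by exists j.+1 => //; rewrite segmentS.
Qed.

Lemma affB_act_segmentV N b j x : (j < 2 * n)%N ->
  affB_act N (segment n b j)^-1%g x =
  twist N b (foldr (point_act n N) (twist N b x) (rev (segment_word n j))).
Proof.
move=> lt; rewrite segmentE -wprod_rev affB_act_wprod /colored_word -map_rev.
by rewrite foldr_colored_word // all_rev segment_word_bounds.
Qed.

Lemma min_rep_segment_ascent b u j : (j < 2 * n)%N -> min_rep (omit (~~ b)) u ->
  min_rep (omit b) (u * segment n b j)%g <->
  (ell (u * segment n b j)%g < ell (u * segment n b j * s (inord (~~ b)))%g)%N.
Proof.
move=> lt mu; have [mj ej] := segment_min_rep b lt; have pj := segment_parabolic b lt.
have bK : (inord (~~ b) : 'I_n.+1) = ~~ b :> nat by rewrite inordK //; case: (b); lia.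
split=> [mw|asc]; first by apply: min_rep_ascent mw _; rewrite /omit bK; case: (b).
apply: min_rep_of_ascents => i oi.
have [/eqP Ei|oi'] := boolP ((i : nat) == ~~ b).
  suff -> : i = inord (~~ b) by [].
  by apply: val_inj; rewrite /= bK.
rewrite -monoid.mulgA (ell_min_repM mu pj) (ell_min_repM mu); last first.
  by apply: parabolicM pj _; apply: parabolic_gen.
by rewrite ltn_add2l; apply: min_rep_ascent mj _.
Qed.

(* As u and u * segment i are minimal, the inverse image of an interior point
   under u is dominant and the one under u * segment i lies above the wall 0. *)
Lemma min_rep_segment2 b u i j : (0 < i < 2 * n)%N -> (0 < j < 2 * n)%N ->
  min_rep (omit b) u -> min_rep (omit (~~ b)) (u * segment n (~~ b) i)%g ->
  min_rep (omit b) (u * segment n (~~ b) i * segment n b j)%g <-> part_rel n j i.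
Proof.
move=> i_bd j_bd mu mui.
have /andP[_ lti] := i_bd; have /andP[_ ltj] := j_bd.
rewrite (min_rep_segment_ascent ltj mui) -ascent_wall !monoid.invgM !affB_actM.
set N := (2 * n)%N%:Z; set y := affB_act N u^-1%g _.
have bn (c : bool) : (c < n.+1)%N by case: c => //; lia.
rewrite affB_act_segmentV // (affB_act_segmentV N (~~ b)) //.
rewrite /node_wall inordK // point_wall_twistN // twist_twistN.
rewrite dominant_segments_wall //.
- move=> k lek; have /(min_rep_ascent mu) : omit b (inord (relabel (~~ b) k) : 'I_n.+1).
    by rewrite -{1}(negbK b) omit_relabel.
  rewrite -ascent_wall -/N -/y /node_wall inordK ?ltnS ?relabel_le //.
  by rewrite -{1}(twistK N (~~ b) y) point_wall_relabel.
- by rewrite /N; lia.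
have /(min_rep_ascent mui) : omit (~~ b) (inord b : 'I_n.+1).
  by rewrite /omit inordK //; case: (b).
rewrite -ascent_wall monoid.invgM affB_actM -/N -/y affB_act_segmentV //.
by rewrite /node_wall inordK // -{1}(negbK b) point_wall_twistN.
Qed.

Fixpoint shape_word b (la : seq nat) : seq 'I_n.+1 :=
  if la is j :: la' then shape_word (~~ b) la' ++ colored_word n b (segment_word n j)
  else [::].

Definition shape_elt b (la : seq nat) : affB n := wp (shape_word b la).

(* The shapes of minimal coset representatives, followed by any number of zeros:
   parts below n are distinct, parts from n on may repeat. *)
Definition padded_rel (a c : nat) :=
  ((c < a) || ((a == c) && ((n <= a) || (a == 0))))%N.

Definition padded_shape (la : seq nat) :=
  sorted padded_rel la && all (fun j => j < 2 * n)%N la.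

Lemma padded_shape_behead j la : padded_shape (j :: la) ->
  padded_shape la /\ (j < 2 * n)%N.
Proof. by case/andP => /path_sorted so /= /andP[-> al]; rewrite /padded_shape so. Qed.

Lemma padded_shape0 la : padded_shape (0%N :: la) -> la = nseq (size la) 0%N.
Proof.
case/andP => /= + _; elim: la => //= j la IH /andP[+ p].
rewrite /padded_rel ltn0 /= => /andP[/eqP Ej _]; rewrite -Ej in p *.
by rewrite {1}(IH p).
Qed.

Lemma shape_word_nseq0 b k : shape_word b (nseq k 0%N) = [::].
Proof. by elim: k b => //= k IH b; rewrite IH. Qed.

Lemma shape_word_cat0 b la k : shape_word b (la ++ nseq k 0%N) = shape_word b la.
Proof. by elim: la b => [|j la IH] b /=; rewrite ?shape_word_nseq0 ?IH. Qed.

Lemma shape_elt_cat0 b la k : shape_elt b (la ++ nseq k 0%N) = shape_elt b la.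
Proof. by rewrite /shape_elt shape_word_cat0. Qed.

Lemma shape_elt_cons b j la :
  shape_elt b (j :: la) = (shape_elt (~~ b) la * segment n b j)%g.
Proof. by rewrite /shape_elt /= wprod_cat. Qed.

Lemma size_shape_word b la : padded_shape la -> size (shape_word b la) = sumn la.
Proof.
elim: la b => //= j la IH b /padded_shape_behead[v lt].
by rewrite size_cat IH // size_map size_segment_word // addnC.
Qed.

Lemma shape_elt_min_rep b la : padded_shape la ->
  min_rep (omit b) (shape_elt b la) /\ ell (shape_elt b la) = sumn la.
Proof.
have [k] := ubnP (size la); elim: k la b => // k IH la b; rewrite ltnS.
case: la => [|j la] /=.
  by rewrite /shape_elt wprod_nil ell1; split=> //; apply: min_rep1.
move=> lek v; have [v' ltj] := padded_shape_behead v.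
have [mu eu] := IH la (~~ b) lek v'; have [mj ej] := segment_min_rep b ltj.
have pj := segment_parabolic b ltj.
rewrite shape_elt_cons (ell_min_repM mu pj) ej eu addnC; split=> //.
case: la lek v v' mu eu => [|i la] lek v v' mu eu.
  by rewrite /shape_elt wprod_nil monoid.mul1g.
have [i0|i0] := posnP i.
  rewrite i0 in v'; rewrite i0 (padded_shape0 v') -[0%N :: _]/(nseq (size la).+1 0%N).
  by rewrite /shape_elt shape_word_nseq0 wprod_nil monoid.mul1g.
have [v'' lti] := padded_shape_behead v'.
have j0 : (0 < j)%N by case/andP: v => /= /andP[+ _] _; rewrite /padded_rel; lia.
move: mu; rewrite shape_elt_cons negbK => mu.
have [mla _] := IH la b (ltnW lek) v''.
apply/(min_rep_segment2 _ _ mla mu); rewrite ?i0 ?j0 //.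
by case/andP: v => /= /andP[+ _] _; rewrite /padded_rel /part_rel; lia.
Qed.

Lemma shape_elt_inj b la mu : size la = size mu -> padded_shape la -> padded_shape mu ->
  shape_elt b la = shape_elt b mu -> la = mu.
Proof.
elim: la mu b => [|j la IH] [|i mu] //= b [sz] v1 v2.
have [v1' lt1] := padded_shape_behead v1; have [v2' lt2] := padded_shape_behead v2.
rewrite !shape_elt_cons.
have [m1 _] := shape_elt_min_rep (~~ b) v1'.
have [m2 _] := shape_elt_min_rep (~~ b) v2'.
case/(min_rep_factor_uniq m1 m2 (segment_parabolic b lt1) (segment_parabolic b lt2)).
move=> /(IH _ _ sz v1' v2')-> eq_seg; congr (_ :: _).
have [_ <-] := segment_min_rep b lt1; have [_ <-] := segment_min_rep b lt2.
by rewrite eq_seg.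
Qed.

Lemma affB_shape_padded b w la : affB_shape b w la ->
  [/\ padded_shape la, all (leq 1) la & w = shape_elt b la].
Proof.
elim=> {b w la} [b|b w u j la _ mw mu pj lej Ew _ sh [v al Eu]].
  by rewrite /shape_elt wprod_nil.
have ltj : (j < 2 * n)%N by lia.
split; rewrite ?shape_elt_cons -?Eu //=; last by rewrite al; lia.
have [so al'] := andP v; rewrite /padded_shape /= al' ltj andbT.
case: la sh v al Eu so al' => [|i la] //= sh v /andP[i0 al] Eu -> /andP[lti _].
rewrite andbT; have [v' _] := padded_shape_behead v.
have [mla _] := shape_elt_min_rep b v'.
move: mw mu; rewrite Ew Eu shape_elt_cons negbK => mw mu.
have lti' : (0 < i < 2 * n)%N by rewrite i0.
have ltj' : (0 < j < 2 * n)%N by lia.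
have := min_rep_segment2 lti' ltj' mla mu; rewrite /part_rel /padded_rel => -[/(_ mw)].
lia.
Qed.

Lemma min_rep_omit_both b w : min_rep (omit b) w -> min_rep (omit (~~ b)) w -> w = 1%g.
Proof.
move=> mw mw'; have mT : min_rep xpredT w.
  apply: min_rep_of_ascents => i _; have [|] := boolP (omit b i).
    exact: min_rep_ascent mw.
  rewrite /omit negbK => /eqP Ei; apply: min_rep_ascent mw' _.
  by rewrite /omit Ei; case: (b).
have pT v : parabolic xpredT v.
  by have [a <- _] := reduced_word v; apply/parabolic_wprod/all_predT.
rewrite -[w]monoid.mul1g.
by rewrite (min_rep_coset_inj (@min_rep1 _ _ _) _ (pT w)) monoid.mul1g.
Qed.

Lemma affB_shape_exists b w : min_rep (omit b) w -> exists la, affB_shape b w la.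
Proof.
have [k] := ubnP (ell w); elim: k w b => // k IH w b; rewrite ltnS => lek mw.
have [->|w1] := eqVneq w 1%g; first by exists [::]; apply: affB_shape_nil.
have [u [v [mu pv Ew]]] := min_rep_factor (omit (~~ b)) w.
have el := ell_min_repM mu pv.
have mv : min_rep (omit b) v by apply: (@min_rep_right_factor _ _ _ u);
  rewrite -?Ew // Ew.
have [j lt Ev] := parabolic_min_segment mv pv.
have [mj ej] := segment_min_rep b lt.
have j0 : (0 < j)%N.
  rewrite lt0n; apply: contraNneq w1 => j0; apply/eqP/(min_rep_omit_both mw).
  by rewrite Ew Ev j0 segmentE wprod_nil monoid.mulg1.
have [|la sh] := IH u (~~ b) _ mu.
  by apply: leq_trans lek; rewrite Ew el Ev ej; lia.
exists (j :: la); apply: (affB_shape_cons (u := u)) => //; rewrite -?Ev //.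
- exact/eqP.
- lia.
by rewrite Ew.
Qed.

Lemma min_rep_shape b v : min_rep (omit b) v ->
  exists la, [/\ padded_shape la, all (leq 1) la & v = shape_elt b la].
Proof. by case/affB_shape_exists => la /affB_shape_padded[v_la pos Ev]; exists la. Qed.

Lemma affB_pi_shape w : min_rep (omit false) w ->
  [/\ padded_shape (affB_pi w), all (leq 1) (affB_pi w) &
      w = shape_elt false (affB_pi w)].
Proof.
case/affB_shape_exists => la sh; apply: affB_shape_padded.
exact: (@xgetI _ [::] [set la | affB_shape false w la]%classic la sh).
Qed.

End Factorization.

Section PoincareCoefficients.
Variables (I : finType) (m : coxmat I) (J : pred I).
Implicit Types v w : coxeter m.

Definition ideal_count w i :=
  count (fun v => ell v == i) (fset_set (lower_ideal J w)).

Lemma coef_poincare w i : ((poincare J w)`_i = (ideal_count w i)%:R)%R.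
Proof.
rewrite /poincare fsbig_finite /=; last exact: finite_lower_ideal.
rewrite /ideal_count coef_sum -sum1_count GRing.Theory.natr_sum [RHS]big_mkcond /=.
by apply: eq_bigr => v _; rewrite coefXn eq_sym; case: eqP.
Qed.

Lemma palindromicE w : palindromic J w <->
  forall i, i <= ell w -> ideal_count w i = ideal_count w (ell w - i).
Proof.
split=> pal i le; last by rewrite !coef_poincare pal.
have := pal i le; rewrite !coef_poincare => /eqP.
by rewrite Num.Theory.eqr_nat => /eqP.
Qed.

Lemma mem_lower_ideal v w :
  (v \in fset_set (lower_ideal J w)) = `[< min_rep J v /\ bruhat v w >].
Proof.
rewrite in_fset_set; last exact: finite_lower_ideal.
by apply/idP/asboolP => [/set_mem|in_ideal]; last exact/mem_set.
Qed.

Lemma ideal_count_ge w i (T : eqType) (F : coxeter m -> T) (L : seq T) : uniq L ->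
  (forall y, y \in L ->
     exists v : coxeter m, [/\ min_rep J v, bruhat v w, ell v = i & F v = y]) ->
  size L <= ideal_count w i.
Proof.
move=> uL ideal_L; rewrite /ideal_count -size_filter -(size_map F).
apply: uniq_leq_size => // y /ideal_L[v [mv bv ev <-]]; apply: map_f.
by rewrite mem_filter ev eqxx mem_lower_ideal; apply/asboolP.
Qed.

Lemma ideal_count_le w i (L : seq (coxeter m)) :
  (forall v, min_rep J v -> bruhat v w -> ell v = i -> v \in L) ->
  ideal_count w i <= size L.
Proof.
move=> mem_L; rewrite /ideal_count -size_filter; apply: uniq_leq_size.
  by rewrite filter_uniq // fset_uniq.
move=> v; rewrite mem_filter mem_lower_ideal => /andP[/eqP ev /asboolP[mv bv]].
exact: mem_L.
Qed.

Lemma ideal_count_enum w i (L : seq (coxeter m)) : uniq L ->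
  (forall v, v \in L <-> min_rep J v /\ bruhat v w) ->
  ideal_count w i = count (fun v => ell v == i) L.
Proof.
move=> uL memL; apply/permP/uniq_perm; rewrite ?fset_uniq // => v.
by rewrite mem_lower_ideal; apply/asboolP/idP => /memL.
Qed.

End PoincareCoefficients.

(** * The length of a vertex *)

Section VertexLength.
Import Order.TTheory GRing.Theory Num.Theory.
Implicit Types (a b c : int) (A B X Y : seq int) (x : nat -> int).

(* If a root takes values between 0 and 1 on the base alcove and the value c at
   a point, then this many of its hyperplanes strictly separate the two. *)
Definition crossings c := `|c| - (0 < c)%R.

Lemma crossings_1sub c : crossings (1 - c)%R = crossings c.
Proof. by rewrite /crossings; lia. Qed.

Lemma crossings_sub_lt a b : (a < b)%R ->
  crossings (a - b)%R = (crossings (b - a)%R).+1.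
Proof. by rewrite /crossings; lia. Qed.

Definition pair_crossings a b := crossings (a - b)%R + crossings (a + b)%R.

Lemma pair_crossings_1subl a b : pair_crossings (1 - a)%R b = pair_crossings a b.
Proof. by rewrite /pair_crossings /crossings; lia. Qed.

(* The roots of type B take the values x_i, x_i - x_j and x_i + x_j, for i < j. *)
Fixpoint vertex_length X : nat :=
  if X is a :: X' then
    crossings a + \sum_(b <- X') pair_crossings a b + vertex_length X'
  else 0.

Lemma vertex_length_cat A B : vertex_length (A ++ B) =
  vertex_length A + \sum_(a <- A) \sum_(b <- B) pair_crossings a b + vertex_length B.
Proof.
elim: A => [|a A IH] /=; first by rewrite big_nil.
by rewrite IH big_cat big_cons /=; lia.
Qed.

Lemma vertex_length_catl A B B' k :
  (forall a, a \in A ->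
     \sum_(b <- B) pair_crossings a b = \sum_(b <- B') pair_crossings a b) ->
  vertex_length B = vertex_length B' + k ->
  vertex_length (A ++ B) = vertex_length (A ++ B') + k.
Proof.
by move=> eqA eqB; rewrite !vertex_length_cat eqB (eq_big_seq _ eqA) addnA.
Qed.

(* Reflecting in x_i = 0 for x_i < 0 crosses that wall, and moves the walls of
   the later coordinates that do not dominate x_i. *)
Lemma vertex_length_opp A a B : (0 < a)%R ->
  vertex_length (A ++ (- a)%R :: B) = vertex_length (A ++ a :: B) +
    (1 + \sum_(b <- B) ((`|b| <= `|a|) + (`|b| < `|a|))).
Proof.
move=> a_gt0; apply: vertex_length_catl => [c _|] /=.
  by rewrite !big_cons /pair_crossings opprK [X in X + _]addnC.
have -> : \sum_(b <- B) pair_crossings (- a)%R b = \sum_(b <- B) pair_crossings a b +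
    \sum_(b <- B) ((`|b| <= `|a|) + (`|b| < `|a|)).
  rewrite -big_split /=; apply: eq_bigr => b _.
  by rewrite /pair_crossings /crossings; lia.
have -> : crossings (- a)%R = (crossings a).+1 by rewrite /crossings; lia.
lia.
Qed.

Lemma vertex_length_swap A a B b C : (a < b)%R ->
  all (fun c => (c < a) || (b < c))%R B ->
  vertex_length (A ++ a :: B ++ b :: C) = vertex_length (A ++ b :: B ++ a :: C) + 1.
Proof.
move=> lt_ab outB; apply: vertex_length_catl => [c _|] /=.
  by rewrite !(big_cons, big_cat) /=; lia.
have eqB : \sum_(d <- B) pair_crossings a d + \sum_(c <- B) pair_crossings c b =
    \sum_(d <- B) pair_crossings b d + \sum_(c <- B) pair_crossings c a.
  rewrite -!big_split /=; apply: eq_big_seq => c /(allP outB) /=.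
  rewrite /pair_crossings (addrC c b) (addrC c a) => /orP[lt_ca|lt_bc].
    by rewrite (crossings_sub_lt lt_ca) (crossings_sub_lt (lt_trans lt_ca lt_ab)); ring.
  by rewrite (crossings_sub_lt lt_bc) (crossings_sub_lt (lt_trans lt_ab lt_bc)); ring.
have cross d : \sum_(c <- B) \sum_(e <- d :: C) pair_crossings c e =
    \sum_(c <- B) pair_crossings c d + \sum_(c <- B) \sum_(e <- C) pair_crossings c e.
  by rewrite -big_split /=; apply: eq_bigr => c _; rewrite big_cons.
have eq_ab : pair_crossings a b = (pair_crossings b a).+1.
  by rewrite /pair_crossings (addrC b a) crossings_sub_lt.
by rewrite !vertex_length_cat /= !big_cat !big_cons /= !cross eq_ab; lia.
Qed.

End VertexLength.

(** * Vertices of the alcoves as lists of coordinates *)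

Ltac size_lia :=
  do 3 rewrite ?size_cat ?size_rcons ?size_nseq ?size_map ?size_rev ?size_iota /=; lia.

Section Vertices.
Import Order.TTheory GRing.Theory Num.Theory.
Local Open Scope ring_scope.
Variable n : nat.
Hypothesis n_ge3 : (2 < n)%N.
Implicit Types (b : bool) (A B C X Y : seq int) (x y : nat -> int) (w t : affB n).
Local Notation wp := (wprod (affB_mat n)).
Local Notation act := (point_act n 1).

Definition pt X : nat -> int := fun k => nth 0 X k.
Arguments pt : simpl never.

Lemma origin_pt : origin = pt (nseq n 0).
Proof. by apply/funext => k; rewrite /pt nth_nseq; case: ifP. Qed.

Lemma flip_pt (a : int) X : flip 1 (pt (a :: X)) = pt (1 - a :: X).
Proof. by apply/funext => -[|k]. Qed.

Lemma pt_catr A X d : pt (A ++ X) (size A + d) = pt X d.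
Proof. by rewrite /pt nth_cat ltnNge leq_addr addKn. Qed.

Lemma act_swap A (a a' : int) B : (size A + size B).+2 = n ->
  act (size A).+1 (pt (A ++ a :: a' :: B)) = pt (A ++ a' :: a :: B).
Proof.
move=> sz; apply/funext => k; rewrite /point_act.
have lt2 : ((size A).+1 < n)%N by lia.
have at_a : pt (A ++ a :: a' :: B) (size A) = a by rewrite -(addn0 (size A)) pt_catr.
have at_a' : pt (A ++ a :: a' :: B) (size A).+1 = a' by rewrite -addn1 pt_catr.
rewrite /= lt2 at_a at_a'.
have [lt|ge] := ltnP k (size A); first by decide_ifs; rewrite /pt !nth_cat lt.
have [[|[|d]] ->] : exists d, k = (size A + d)%N by exists (k - size A)%N; lia.
all: by rewrite !pt_catr; decide_ifs.
Qed.

Lemma act_opp A (a : int) : (size A).+1 = n ->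
  act n (pt (A ++ [:: a])) = pt (A ++ [:: - a]).
Proof.
move=> sz; apply/funext => k; rewrite /point_act ltnn; decide_ifs.
  by rewrite -sz /= /pt !nth_cat ltnn subnn (_ : k = size A) ?ltnn ?subnn //; lia.
have [lt|ge] := ltnP k (size A); first by rewrite /pt !nth_cat lt.
by rewrite /pt !nth_default ?size_cat /=; lia.
Qed.

Lemma act_rotate A (a : int) B C : (size A + size B + size C).+1 = n ->
  foldr act (pt (A ++ a :: B ++ C)) (rev (iota (size A).+1 (size B)))
  = pt (A ++ B ++ a :: C).
Proof.
elim: B A => [|b B IH] A /= sz //.
rewrite rev_cons foldr_rcons act_swap; last by rewrite size_cat; lia.
have := IH (rcons A b); rewrite size_rcons !cat_rcons => -> //=; lia.
Qed.

Definition vertex_rank x := vertex_length (mkseq x n).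

Lemma vertex_rank_pt X : size X = n -> vertex_rank (pt X) = vertex_length X.
Proof. by move=> sz; rewrite /vertex_rank -sz mkseq_nth. Qed.

Lemma vertex_rank_flip x : vertex_rank (flip 1 x) = vertex_rank x.
Proof.
rewrite /vertex_rank /mkseq -(prednK (ltnW (ltnW n_ge3))) /= crossings_1sub.
congr (_ + _ + vertex_length _)%N; rewrite ?big_map; last first.
  by apply/eq_in_map => k; rewrite mem_iota /flip; case: k.
apply: eq_big_seq => k; rewrite mem_iota /flip pair_crossings_1subl; case: k => //.
Qed.

Lemma vertex_rank_twist b x : vertex_rank (twist 1 b x) = vertex_rank x.
Proof. by case: b => //; apply: vertex_rank_flip. Qed.

Lemma vertex_rank_act k x : (0 < k <= n)%N ->
  vertex_rank (act k x) = vertex_rank (act k (pt (mkseq x n))).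
Proof.
move=> lek; congr vertex_length; apply/eq_in_map => l; rewrite mem_iota => ltl.
by rewrite /point_act /pt; decide_ifs; rewrite ?nth_mkseq //; lia.
Qed.

Lemma vertex_rank_act_swap k x : (k.+1 < n)%N -> x k.+1 < x k ->
  vertex_rank (act k.+1 x) = (vertex_rank x).+1.
Proof.
move=> ltk; rewrite vertex_rank_act ?(ltnW ltk) //.
have Xk l : (l < n)%N -> x l = nth 0 (mkseq x n) l by move=> ltl; rewrite nth_mkseq.
rewrite !Xk ?(ltnW ltk) // /(vertex_rank x); set X := mkseq x n => lt.
have szX : size X = n by rewrite size_mkseq.
have EX : X = take k X ++ nth 0 X k :: nth 0 X k.+1 :: drop k.+2 X.
  by rewrite -!drop_nth ?szX ?(ltnW ltk) // cat_take_drop.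
have szA : size (take k X) = k by rewrite size_takel // szX; lia.
have szB : size (drop k.+2 X) = (n - k.+2)%N by rewrite size_drop szX.
rewrite {1}EX -{1}szA act_swap ?szA ?szB; last by lia.
rewrite vertex_rank_pt; last by rewrite size_cat /= szA szB; lia.
have /= -> := @vertex_length_swap (take k X) _ [::] _ (drop k.+2 X) lt isT.
by rewrite -EX addn1.
Qed.

Lemma vertex_rank_act_opp x : 0 < x n.-1 ->
  vertex_rank (act n x) = (vertex_rank x).+1.
Proof.
have n0 : (0 < n)%N by lia.
rewrite vertex_rank_act ?n0 ?leqnn // /(vertex_rank x).
have -> : x n.-1 = nth 0 (mkseq x n) n.-1 by rewrite nth_mkseq ?prednK.
set X := mkseq x n => gt0; have szX : size X = n by rewrite size_mkseq.
have EX : X = take n.-1 X ++ [:: nth 0 X n.-1].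
  rewrite -[LHS](cat_take_drop n.-1) (drop_nth 0) ?szX ?prednK //.
  by rewrite drop_oversize ?szX.
have szA : size (take n.-1 X) = n.-1 by rewrite size_takel // szX leq_pred.
rewrite {1}EX act_opp ?szA ?prednK // vertex_rank_pt;
  last by rewrite size_cat szA /=; lia.
by rewrite vertex_length_opp // -EX big_nil addn1.
Qed.

Lemma vertex_rank_fire_pos k x : (0 < k <= n)%N -> 0 < point_wall n 1 k x ->
  vertex_rank (act k x) = (vertex_rank x).+1.
Proof.
case: k => //= k lek; rewrite /point_wall /=.
case: ltnP => [ltk|gek]; first by rewrite subr_gt0; apply: vertex_rank_act_swap.
have -> : k.+1 = n by lia.
exact: vertex_rank_act_opp.
Qed.

Lemma vertex_rank_fire (i : 'I_n.+1) x : 0 < node_wall 1 i x ->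
  vertex_rank (node_act 1 i x) = (vertex_rank x).+1.
Proof.
rewrite /node_wall /node_act; have lei : (i <= n)%N by rewrite -ltnS.
have [->|i0] := posnP i; last by apply: vertex_rank_fire_pos; rewrite i0.
rewrite -(point_wall_flip n_ge3 1 (k := 0)) // -vertex_rank_flip flip_point_act //=.
by rewrite -[flip_letter 0]/1%N => /vertex_rank_fire_pos->;
  rewrite ?vertex_rank_flip //; lia.
Qed.

Lemma vertex_rank_base b : vertex_rank (base_vertex b) = 0%N.
Proof.
rewrite /base_vertex vertex_rank_twist origin_pt vertex_rank_pt ?size_nseq //.
by elim: n => //= r ->; rewrite addn0 big1_seq // => a /andP[_ /nseqP[->]].
Qed.

Lemma ell_vertex_rank b w : min_rep (omit b) w ->
  ell w = vertex_rank (affB_act 1 w (base_vertex b)).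
Proof.
exact: (ell_rank (affB_game n_ge3 1) (@base_vertex_ge0 n n_ge3 b) (omitE n_ge3 b)
  (vertex_rank_base b) vertex_rank_fire).
Qed.

Definition reflected x y := exists2 t : affB n, reflection t & affB_act 1 t x = y.

Lemma bruhat_reflected b w y : min_rep (omit b) w ->
  reflected (affB_act 1 w (base_vertex b)) y ->
  (vertex_rank y < vertex_rank (affB_act 1 w (base_vertex b)))%N ->
  exists v : affB n,
    [/\ min_rep (omit b) v, bruhat v w & affB_act 1 v (base_vertex b) = y].
Proof.
move=> mw [t rt <-].
exact: (bruhat_reflected_vertex (affB_game n_ge3 1) (@base_vertex_ge0 n n_ge3 b) (omitE n_ge3 b)
  (vertex_rank_base b) vertex_rank_fire mw rt).
Qed.

(** * Reflections in terms of coordinates *)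

Lemma reflected_affB_act w x y :
  reflected (affB_act 1 w x) (affB_act 1 w y) <-> reflected x y.
Proof.
have conj (v : affB n) x' y' : reflected x' y' ->
  reflected (affB_act 1 v x') (affB_act 1 v y').
  case=> t rt <-; exists (v * t * v^-1)%g; first exact: reflection_conj.
  by rewrite -!(affB_actM n_ge3) monoid.mulgVK.
have actK x' : affB_act 1 w^-1%g (affB_act 1 w x') = x'.
  by rewrite -(affB_actM n_ge3) monoid.mulVg -(wprod_nil (affB_mat n)) affB_act_wprod.
by split=> [/(conj w^-1%g)|]; [rewrite !actK | apply: conj].
Qed.

Lemma foldr_act_affB c : all (fun k => 0 < k <= n)%N c ->
  exists w, forall x, foldr act x c = affB_act 1 w x.
Proof.
move=> bc; exists (wp (colored_word n true c)) => x.
by rewrite affB_act_wprod // foldr_colored_word.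
Qed.

Lemma reflected_foldr_act c x y : all (fun k => 0 < k <= n)%N c ->
  reflected (foldr act x c) (foldr act y c) <-> reflected x y.
Proof. by case/foldr_act_affB=> w Ew; rewrite !Ew; apply: reflected_affB_act. Qed.

Lemma reflected_act k x : (k <= n)%N -> reflected x (act k x).
Proof.
move=> lek; exists (gen (affB_mat n) (inord k)); first exact: reflection_gen.
by rewrite -wprod1 affB_act_wprod //= /node_act inordK.
Qed.

Lemma flip_node_act (i : 'I_n.+1) x :
  flip 1 (node_act 1 i x) = node_act 1 (inord (flip_letter i) : 'I_n.+1) (flip 1 x).
Proof.
have lei : (i <= n)%N by rewrite -ltnS.
rewrite /node_act inordK; first exact: flip_point_act.
by rewrite /flip_letter; case: (nat_of_ord i) lei => [|[|k]] /=; lia.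
Qed.

Lemma reflected_flip x y : reflected x y -> reflected (flip 1 x) (flip 1 y).
Proof.
pose flip_word (u : seq 'I_n.+1) : seq 'I_n.+1 :=
  [seq inord (flip_letter i) | i : 'I_n.+1 <- u].
have flip_foldr u z : flip 1 (foldr (@node_act n 1) z u) =
    foldr (@node_act n 1) (flip 1 z) (flip_word u).
  by elim: u => //= i u <-; apply: flip_node_act.
case=> _ [z [i ->]] <-; have [a <- _] := reduced_word z.
rewrite -wprod_rev -wprod_rcons -wprod_cat affB_act_wprod // flip_foldr.
exists (wp (flip_word (rcons a i ++ rev a))); last by rewrite affB_act_wprod.
rewrite /flip_word map_cat map_rcons map_rev wprod_cat wprod_rcons wprod_rev.
by eexists; eexists.
Qed.

Lemma reflected_twist b x y : reflected x y -> reflected (twist 1 b x) (twist 1 b y).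
Proof. by case: b => //; apply: reflected_flip. Qed.

Lemma reflected_rotate A A' (a a' : int) B B' C C' :
  size A = size A' -> size B = size B' -> size C = size C' ->
  (size A + size B + size C).+1 = n ->
  reflected (pt (A ++ a :: B ++ C)) (pt (A' ++ a' :: B' ++ C')) <->
  reflected (pt (A ++ B ++ a :: C)) (pt (A' ++ B' ++ a' :: C')).
Proof.
move=> sA sB sC sz; rewrite -act_rotate // -(@act_rotate A' a'); last by lia.
rewrite -sA -sB reflected_foldr_act // all_rev; apply/allP => k.
by rewrite mem_iota; lia.
Qed.

Lemma reflected_head_opp (a a' : int) X X' : size X = size X' -> (size X).+1 = n ->
  reflected (pt (a :: X)) (pt (a' :: X')) ->
    reflected (pt (- a :: X)) (pt (- a' :: X')).
Proof.
move=> sX sz; have rot (c c' : int) :=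
  @reflected_rotate [::] [::] c c' X X' [::] [::] erefl sX erefl.
have {}rot (c c' : int) : reflected (pt (c :: X)) (pt (c' :: X')) <->
    reflected (pt (X ++ [:: c])) (pt (X' ++ [:: c'])).
  by have := rot c c'; rewrite !cats0 addn0; apply.
move/rot => refl; apply/rot; rewrite -!act_opp -?sX //.
by apply/(@reflected_foldr_act [:: n]) => //=; lia.
Qed.

Lemma reflected_head_add (k a a' : int) X X' : size X = size X' -> (size X).+1 = n ->
  reflected (pt (a :: X)) (pt (a' :: X')) ->
    reflected (pt (a + k :: X)) (pt (a' + k :: X')).
Proof.
move=> sX sz refl; have flip_head (c c' : int) : reflected (pt (c :: X)) (pt (c' :: X')) ->
    reflected (pt (1 - c :: X)) (pt (1 - c' :: X')).
  by move/reflected_flip; rewrite !flip_pt.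
have opp_head := @reflected_head_opp _ _ X X' sX sz.
elim/int_ind: k => [|k|k]; first by rewrite !addr0.
  move/opp_head/flip_head; congr (reflected (pt (_ :: _)) (pt (_ :: _))); lia.
move/flip_head/opp_head; congr (reflected (pt (_ :: _)) (pt (_ :: _))); lia.
Qed.

Lemma reflected_opp A A' (a a' : int) C C' :
  size A = size A' -> size C = size C' -> (size A + size C).+1 = n ->
  reflected (pt (A ++ a :: C)) (pt (A' ++ a' :: C')) ->
  reflected (pt (A ++ - a :: C)) (pt (A' ++ - a' :: C')).
Proof.
move=> sA sC sz /(@reflected_rotate [::] [::]) refl.
apply/(@reflected_rotate [::] [::]) => //.
by apply: reflected_head_opp; rewrite ?size_cat ?sA ?sC //; [lia | apply: refl].
Qed.

Lemma reflected_add A A' (k a a' : int) C C' :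
  size A = size A' -> size C = size C' -> (size A + size C).+1 = n ->
  reflected (pt (A ++ a :: C)) (pt (A' ++ a' :: C')) ->
  reflected (pt (A ++ a + k :: C)) (pt (A' ++ a' + k :: C')).
Proof.
move=> sA sC sz /(@reflected_rotate [::] [::]) refl.
apply/(@reflected_rotate [::] [::]) => //.
by apply: reflected_head_add; rewrite ?size_cat ?sA ?sC //; [lia | apply: refl].
Qed.

Lemma reflected_coord A (a k : int) C : (size A + size C).+1 = n ->
  reflected (pt (A ++ a :: C)) (pt (A ++ 2%:Z * k - a :: C)).
Proof.
move=> sz; have -> : a = a - k + k by rewrite subrK.
have -> : 2%:Z * k - (a - k + k) = - (a - k) + k by ring.
apply: reflected_add => //; rewrite -[C]cats0.
apply/(@reflected_rotate A A _ _ C C [::] [::]) => //.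
  by rewrite addn0.
rewrite !catA -act_opp ?size_cat //.
exact: reflected_act.
Qed.

Lemma reflected_swap A (a : int) B (b : int) C : (size A + size B + size C).+2 = n ->
  reflected (pt (A ++ a :: B ++ b :: C)) (pt (A ++ b :: B ++ a :: C)).
Proof.
move=> sz; apply/(@reflected_rotate A A a b B B (b :: C) (a :: C)) => //=.
  by lia.
rewrite !(catA A B) -(@act_swap (A ++ B) a b) ?size_cat; last by lia.
by apply: reflected_act; lia.
Qed.

Lemma reflected_pair A (a : int) B (b k : int) C : (size A + size B + size C).+2 = n ->
  reflected (pt (A ++ a :: B ++ b :: C)) (pt (A ++ k - b :: B ++ k - a :: C)).
Proof.
move=> sz; rewrite -!cat_cons !catA.
have -> : b = - (k - b) + k by ring.
have -> : k - (- (k - b) + k) = k - b by ring.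
rewrite (addrC k (- a)); apply: reflected_add; rewrite ?size_cat //=; try lia.
apply: reflected_opp; rewrite ?size_cat //=; try lia.
by rewrite -!catA !cat_cons; apply: reflected_swap.
Qed.

End Vertices.

(** * Vertices of shapes *)

Section ShapeVertices.
Import Order.TTheory GRing.Theory Num.Theory.
Local Open Scope ring_scope.
Variable n : nat.
Hypothesis n_ge3 : (2 < n)%N.
Implicit Types (b : bool) (A B X : seq int) (x : nat -> int) (la : seq nat).
Implicit Types (cs : seq (seq nat)).
Local Notation segw := (segment_word n).

Fixpoint rows_word b cs : seq 'I_n.+1 :=
  if cs is c :: cs' then rows_word (~~ b) cs' ++ colored_word n b c else [::].

Lemma shape_wordE b la : shape_word n b la = rows_word b (map segw la).
Proof. by elim: la b => //= j la IH b; rewrite IH. Qed.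

Lemma subseq_rows_word b cs cs' : all2 (fun c' c => subseq c' c) cs' cs ->
  subseq (rows_word b cs') (rows_word b cs).
Proof.
elim: cs' cs b => [|c' cs' IH] [|c cs] //= b /andP[sub_c sub_cs].
by apply: cat_subseq; [apply: IH | apply: map_subseq].
Qed.

(* Conjugation by [flip] exchanges s_0 and s_1, so that reading a row of a shape
   becomes the same operation for both colours. *)
Definition pass x (c : seq nat) := foldr (point_act n 1) (flip 1 x) c.

Lemma foldr_rows_word b x cs : all (all (fun k => 0 < k <= n)%N) cs ->
  foldr (@node_act n 1) (twist 1 (~~ b) x) (rows_word b cs) =
  twist 1 (b (+) ~~ odd (size cs)) (foldl pass x cs).
Proof.
elim: cs b x => [|c cs IH] b x /=; first by rewrite addbT.
case/andP=> bc bcs; rewrite foldr_cat foldr_colored_word // twist_twistN -/(pass x c).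
have := IH (~~ b) (pass x c) bcs; rewrite negbK => ->.
by rewrite addNb -addbN.
Qed.

Lemma segment_words_bounds la : padded_shape n la ->
  all (all (fun k => 0 < k <= n)%N) (map segw la).
Proof.
case/andP=> _ al; rewrite all_map; apply: sub_all al => j /= lt.
exact: segment_word_bounds.
Qed.

Definition shape_point la := foldl pass origin (map segw la).

Lemma shape_elt_vertex b la : padded_shape n la ->
  affB_act 1 (shape_elt n b la) (base_vertex b) =
  twist 1 (b (+) ~~ odd (size la)) (shape_point la).
Proof.
move=> v; rewrite affB_act_wprod //
  shape_wordE foldr_rows_word ?segment_words_bounds //.
by rewrite size_map.
Qed.

Lemma pass_low (a : int) A B : (size A + size B).+1 = n ->
  pass (pt (a :: A ++ B)) (segw (size A)) = pt (A ++ 1 - a :: B).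
Proof.
move=> sz; rewrite /pass segment_act //; last by lia.
apply/funext => k; rewrite /segment_pos /flip /pt /=.
have [lt|gt|->] := ltngtP k (size A); decide_ifs => //.
- by rewrite !nth_cat lt.
- by case: k gt => // k gt; rewrite /= !nth_cat; decide_ifs; rewrite subSn.
- by rewrite nth_cat ltnn subnn.
Qed.

Lemma pass_n (a : int) A : (size A).+1 = n ->
  pass (pt (a :: A)) (segw n) = pt (rcons A (a - 1)).
Proof.
move=> sz; rewrite /pass segment_act //; last by lia.
apply/funext => k; rewrite /segment_pos /flip /pt ltnn (_ : 2 * n - n.+1 = size A)%N;
  last by lia.
rewrite nth_rcons; have [//|gt|_] := ltngtP k (size A); last by rewrite opprB.
by case: k gt => // k gt; rewrite /= nth_default.
Qed.

Lemma passes_n A B : (size A + size B)%N = n ->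
  foldl pass (pt (A ++ B)) (nseq (size A) (segw n)) =
  pt (B ++ map (fun a => a - 1) A).
Proof.
elim: A B => [|a A IH] B /= sz; first by rewrite cats0.
rewrite pass_n ?size_cat; last by lia.
by rewrite -cats1 -catA IH ?cats1 ?size_rcons ?cat_rcons //; lia.
Qed.

Lemma passes_desc A B C : (size A + size B + size C)%N = n ->
  foldl pass (pt (A ++ B ++ C)) (map segw (rev (iota (size B) (size A)))) =
  pt (B ++ rev (map (fun a => 1 - a) A) ++ C).
Proof.
elim: A C => [|a A IH] C //= sz.
rewrite -/(iota (size B) (size A).+1) -addn1 iotaD cats1 rev_rcons /= addnC -size_cat.
rewrite catA pass_low ?size_cat; last by lia.
by rewrite -catA IH /= ?rev_cons ?cat_rcons //; lia.
Qed.

Lemma shape_point_power q e r : n = (e + r.+1)%N ->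
  shape_point (nseq (q * n + r.+1) n) = pt (nseq e (- q%:Z) ++ nseq r.+1 (- q.+1%:Z)).
Proof.
move=> En; rewrite /shape_point map_nseq addnC nseqD foldl_cat.
have -> : foldl pass origin (nseq r.+1 (segw n)) = pt (nseq e 0 ++ nseq r.+1 (- 1)).
  have := @passes_n (nseq r.+1 0) (nseq e 0);
    rewrite !size_nseq map_nseq -nseqD addnC -En.
  by rewrite -origin_pt => ->.
elim: q => [|q IH]; first by rewrite /= oppr0.
rewrite mulSnr nseqD foldl_cat IH; set X := nseq e _ ++ _.
have sX : size X = n by rewrite size_cat !size_nseq.
have := @passes_n X [::]; rewrite cats0 addn0 sX => -> //=.
by rewrite map_cat !map_nseq; congr (pt (nseq _ _ ++ _ :: nseq _ _)); lia.
Qed.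

Lemma shape_point_power_stair q e r : n = (e + r.+1)%N ->
  shape_point (nseq (q * n + r.+1) n ++ staircase (n - 1)) =
  pt (- q.+1%:Z :: nseq r q.+2%:Z ++ nseq e q.+1%:Z).
Proof.
move=> En; rewrite /shape_point map_cat foldl_cat -/(shape_point _) (shape_point_power q En).
have := @passes_desc (nseq e (- q%:Z) ++ nseq r (- q.+1%:Z)) [:: - q.+1%:Z] [::].
rewrite /= cats0 size_cat !size_nseq (_ : n - 1 = e + r)%N; last by lia.
have -> : nseq e (- q%:Z) ++ - q.+1%:Z :: nseq r (- q.+1%:Z) =
    (nseq e (- q%:Z) ++ nseq r (- q.+1%:Z)) ++ [:: - q.+1%:Z].
  by rewrite -catA; congr (_ ++ _); elim: r {En} => //= r <-.
move=> ->; last by lia.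
rewrite map_cat rev_cat !map_nseq !rev_nseq.
by congr (pt (_ :: nseq _ _ ++ nseq _ _)); lia.
Qed.

Lemma sumn_vertex_length la X : padded_shape n la -> size X = n ->
  shape_point la = pt X -> sumn la = vertex_length X.
Proof.
move=> v sX EX; have [mla <-] := shape_elt_min_rep n_ge3 false v.
rewrite (ell_vertex_rank n_ge3 mla) shape_elt_vertex // vertex_rank_twist // EX.
exact: vertex_rank_pt.
Qed.

End ShapeVertices.

(** * Non-palindromic shapes *)

Section NotPalindromic.
Variable n : nat.
Hypothesis n_ge3 : 2 < n.
Implicit Types (la mu l : seq nat) (a c p k : nat) (w : affB n).
Local Notation elt := (shape_elt n false).
Local Notation pal la := (palindromic (@omit n false) (shape_elt n false la)).
Local Notation padded := (padded_shape n).

Lemma ideal_count_shapes_le w k (K : seq (seq nat)) :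
  (forall mu, padded mu -> all (leq 1) mu -> sumn mu = k -> mu \in K) ->
  ideal_count (omit false) w k <= size K.
Proof.
move=> mem_K; rewrite -(size_map elt); apply: ideal_count_le => v mv _ ev.
have [mu [vmu pmu Ev]] := min_rep_shape n_ge3 mv; rewrite Ev; apply: map_f;
  apply: mem_K => //.
by have [_ <-] := shape_elt_min_rep n_ge3 false vmu; rewrite -Ev.
Qed.

Lemma ideal_count1_le w : ideal_count (omit false) w 1 <= 1.
Proof.
apply: (@ideal_count_shapes_le _ _ [:: [:: 1]]) => -[|a mu] //= _ /andP[a0 pos] sum1.
have -> : a = 1 by lia.
by rewrite (sumn_eq0_positive pos) //; lia.
Qed.

Lemma ideal_count2_le w : ideal_count (omit false) w 2 <= 1.
Proof.
apply: (@ideal_count_shapes_le _ _ [:: [:: 2]]) =>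
  -[|a mu] //= /andP[/= so _] /andP[a0 pos].
case: mu so pos => [|c mu] /=; first by rewrite addn0 => _ _ ->.
by rewrite /padded_rel => /andP[r _] /andP[c0 _]; lia.
Qed.

Lemma ideal_count4_le w : 3 < n -> ideal_count (omit false) w 4 <= 2.
Proof.
move=> n4; apply: (@ideal_count_shapes_le _ _ [:: [:: 4]; [:: 3; 1]]).
move=> [|a mu] //= /andP[/= so _] /andP[a0 pos] E.
case: mu so pos E => [|c mu] /=; first by rewrite addn0 => _ _ ->.
rewrite /padded_rel => /andP[r so] /andP[c0 pos] E.
case: mu so pos E => [|d mu] /=.
  by move=> _ _ E; have [-> ->] : a = 3 /\ c = 1 by lia.
by rewrite /padded_rel => /andP[r' _] /andP[d0 _] E; lia.
Qed.

Lemma bruhat_contained la mu : padded la -> padded mu -> all2 leq mu la ->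
  bruhat (elt mu) (elt la).
Proof.
move=> vla vmu le; have [_ ela] := shape_elt_min_rep n_ge3 false vla.
apply: subword_bruhat; last by rewrite /reduced ela size_shape_word.
rewrite !shape_wordE; apply: subseq_rows_word.
case/andP: vla => _; elim: mu la le {vmu ela} =>
  [|i mu IH] [|j la] //= /andP[lij le] /andP[lt al].
by rewrite segment_word_subseq // IH.
Qed.

Lemma not_palindromic w k N : k <= ell w -> ideal_count (omit false) w k <= N ->
  N < ideal_count (omit false) w (ell w - k) -> ~ palindromic (omit false) w.
Proof.
move=> lek leN ltN /palindromicE/(_ k lek) eqN.
by move: ltN; rewrite -eqN ltnNge leN.
Qed.

Lemma not_palindromic_shapes la k N (M : seq (seq nat)) : padded la -> k <= sumn la ->
  ideal_count (omit false) (elt la) k <= N -> uniq M -> N < size M ->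
  (forall mu, mu \in M ->
     [/\ padded mu, size mu = size la, sumn mu + k = sumn la & all2 leq mu la]) ->
  ~ pal la.
Proof.
move=> vla lek leN uM ltN below_M; have [mla ela] := shape_elt_min_rep n_ge3 false vla.
apply: (not_palindromic _ leN); rewrite ela //; apply: leq_trans ltN _.
rewrite -(size_map elt); apply: (@ideal_count_ge _ _ _ _ _ _ id).
  rewrite map_inj_in_uniq // => mu mu' /below_M[v1 s1 _ _] /below_M[v2 s2 _ _].
  by apply: (shape_elt_inj n_ge3) => //; rewrite s1 s2.
move=> _ /mapP[mu /below_M[vmu _ su le] ->].
have [mmu emu] := shape_elt_min_rep n_ge3 false vmu.
by exists (elt mu); split=> //; [apply: bruhat_contained | rewrite emu; lia].
Qed.

Definition reflects_down k X Y : Prop :=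
  [/\ size Y = n, vertex_length X = vertex_length Y + k & reflected n (pt X) (pt Y)].

Lemma not_palindromic_reflections la X k N (Ys : seq (seq int)) : padded la ->
  shape_point n la = pt X -> size X = n ->
  ideal_count (omit false) (elt la) k <= N -> uniq Ys -> N < size Ys -> 0 < k ->
  (forall Y, Y \in Ys -> reflects_down k X Y) ->
  ~ pal la.
Proof.
move=> vla EX sX leN uY ltN k0 down_Ys.
have [mla ela] := shape_elt_min_rep n_ge3 false vla.
rewrite (sumn_vertex_length n_ge3 vla sX EX) in ela.
have Ela := shape_elt_vertex n_ge3 false vla; rewrite EX in Ela.
set b := (_ (+) _) in Ela.
have lek : k <= ell (elt la).
  case: Ys ltN down_Ys {uY} => // Y Ys _ /(_ Y (mem_head _ _))[_ + _].
  by rewrite ela; lia.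
apply: (not_palindromic lek leN); apply: leq_trans ltN _; rewrite ela.
apply: (@ideal_count_ge _ _ _ _ _ _
  (fun v => mkseq (twist 1 b (affB_act 1 v (base_vertex false))) n)) => //.
move=> Y /down_Ys[sY lenY refl].
have rankY : vertex_rank n (twist 1 b (pt Y)) = vertex_length X - k.
  by rewrite vertex_rank_twist // vertex_rank_pt // lenY addnK.
have [] := @bruhat_reflected _ n_ge3 false (elt la) (twist 1 b (pt Y)) mla.
- by rewrite Ela; apply: reflected_twist.
- by rewrite Ela rankY vertex_rank_twist // vertex_rank_pt //; lia.
move=> v [mv bv Ev]; exists v; split=> //.
  by rewrite (ell_vertex_rank n_ge3 mv) Ev.
by rewrite Ev twistK -sY mkseq_nth.
Qed.

End NotPalindromic.

Section LoweredParts.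
Variable n : nat.
Hypothesis n_ge3 : 2 < n.
Implicit Types (la mu l : seq nat) (a c p k : nat).
Local Notation pal la := (palindromic (@omit n false) (shape_elt n false la)).
Local Notation padded := (padded_shape n).

Lemma padded_cat_cons l a l' : padded (l ++ a :: l') =
  padded (rcons l a) && padded (a :: l').
Proof.
rewrite /padded_shape sorted_cat_cons all_cat all_rcons /=.
by case: sorted; case: path; case: (a < _); case: all; case: all.
Qed.

Lemma padded_rcons_lt l a c : c < a -> padded (rcons l a) -> padded (rcons l c).
Proof.
move=> lt /andP[so al]; apply/andP; split.
  by case: l so {al} => //= x l; rewrite !rcons_path => /andP[->];
    rewrite /padded_rel; lia.
by move: al; rewrite !all_rcons => /andP[lta ->]; rewrite andbT; lia.
Qed.

(* Consecutive parts a, c such that lowering a by one violates the shape condition. *)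
Definition tight_rel a c := ((a == c) && (n <= c)) || ((a == c.+1) && (a <= n)).

Lemma not_tight_not_palindromic la : padded la -> all (leq 1) la ->
  ~~ sorted tight_rel la -> ~ pal la.
Proof.
move=> vla pos /not_sorted_split[l [a [c [l' [Ela ne]]]]].
have [h [p Ehp]] : exists h p, la = rcons h p.
  by case/lastP: la Ela {vla pos} => [|h p] E; [case: l E | exists h, p].
have p0 : 0 < p by move: pos; rewrite Ehp all_rcons => /andP[].
have a0 : 0 < a by move: pos; rewrite Ela all_cat /= => /and3P[].
have v1 : padded (l ++ [:: a.-1, c & l']).
  move: vla; rewrite Ela !padded_cat_cons => /andP[v1 v2].
  apply/andP; split; first by apply: padded_rcons_lt v1; lia.
  case/andP: v2 => /= /andP[r so] /and3P[l1 l2 l3].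
  rewrite /padded_shape /= so l2 l3 !andbT; apply/andP; split; last by lia.
  by move: ne r; rewrite /padded_rel /tight_rel; lia.
have v2 : padded (rcons h p.-1).
  by apply: (@padded_rcons_lt _ p); rewrite -?Ehp //; lia.
apply: (not_palindromic_shapes n_ge3 (M := [:: l ++ [:: a.-1, c & l']; rcons h p.-1])
  vla _ (ideal_count1_le n_ge3 _)) => //.
- by rewrite Ehp sumn_rcons; lia.
- rewrite /= inE andbT; apply/eqP => /(congr1 (last 0));
    rewrite last_rcons last_cat /= => E.
  by have := congr1 (last 0) Ela; rewrite Ehp last_rcons last_cat /=; lia.
move=> mu; rewrite !inE => /orP[]/eqP->; split=> //.
- by rewrite Ela !size_cat.
- by rewrite Ela !sumn_cat /=; lia.
- by rewrite Ela all2_cat ?all2_refl //= leq_pred leqnn all2_refl.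
- by rewrite Ehp !size_rcons.
- by rewrite Ehp !sumn_rcons; lia.
- by rewrite Ehp -!cats1 all2_cat ?all2_refl //= leq_pred.
Qed.

Lemma tight_corank2_not_palindromic l a p : padded (l ++ [:: a; p]) ->
  tight_rel a p -> 1 < p -> ~~ ((a == n) && (p == n)) -> ~ pal (l ++ [:: a; p]).
Proof.
move=> v r p1 ne; have a0 : 0 < a by move: r; rewrite /tight_rel; lia.
have [w1 w2] : padded (rcons l a) /\ padded [:: a; p].
  by move: v; rewrite padded_cat_cons => /andP.
have v1 : padded (l ++ [:: a; p - 2]).
  rewrite padded_cat_cons w1; apply: (@padded_rcons_lt [:: a] p); rewrite //.
  by lia.
have v2 : padded (l ++ [:: a.-1; p.-1]).
  rewrite padded_cat_cons (padded_rcons_lt _ w1) /=; last by lia.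
  by move: r ne w2; rewrite /tight_rel /padded_shape /= /padded_rel; lia.
apply: (not_palindromic_shapes n_ge3
  (M := [:: l ++ [:: a; p - 2]; l ++ [:: a.-1; p.-1]]) v _
  (ideal_count2_le n_ge3 _)) => //.
- by rewrite sumn_cat /=; lia.
- by rewrite /= inE andbT eqseq_cat // eqxx /= !eqseq_cons; lia.
move=> mu; rewrite !inE => /orP[]/eqP->; split; rewrite ?size_cat ?sumn_cat //=;
  try lia.
  by rewrite all2_cat ?all2_refl //= leqnn leq_subr.
by rewrite all2_cat ?all2_refl //= !leq_pred.
Qed.

Lemma tight_end_n l : sorted tight_rel (rcons l n) -> rcons l n = nseq (size l).+1 n.
Proof.
elim/last_ind: l => // l y IH; rewrite -cats1 cat_rcons sorted_cat_cons /= =>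
  /and3P[so r _].
have Ey : y = n by move: r; rewrite /tight_rel; lia.
rewrite Ey in so *; rewrite -cat_rcons IH // size_nseq cats1.
by elim: (size l).+1 => //= k ->.
Qed.

Lemma tight_end l p : 0 < p < n -> sorted tight_rel (rcons l p) ->
  (exists2 k, p <= k < n & rcons l p = rev (iota p (k - p).+1)) \/
  (exists2 m, 0 < m & rcons l p = nseq m n ++ rev (iota p (n - p))).
Proof.
elim/last_ind: l p => [|l y IH] p /andP[p0 pn].
  by move=> _; left; exists p; rewrite ?leqnn // subnn.
rewrite -cats1 cat_rcons sorted_cat_cons /= => /and3P[so r _].
have [Ey yn] : y = p.+1 /\ y <= n by move: r; rewrite /tight_rel; lia.
have -> : l ++ [:: y; p] = rcons (rcons l y) p by rewrite -!cats1 -catA.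
have [Eyn|ne] := eqVneq y n.
  right; exists (size l).+1 => //; rewrite Eyn in so *; rewrite tight_end_n //.
  by rewrite -cats1; have -> : n - p = 1 by lia.
have [|[k lek E]|[m m0 E]] := IH y _ so; first by lia.
  left; exists k; first by lia.
  rewrite E Ey; have -> : k - p = (k - p.+1).+1 by lia.
  by rewrite -rev_cons.
right; exists m => //; rewrite E Ey; have -> : n - p = (n - p.+1).+1 by lia.
by rewrite rcons_cat -rev_cons.
Qed.

End LoweredParts.

(* The shapes (n^m) and (n^m, n-1, ..., 1), on which no part but the last can
   be lowered: further elements are found by reflecting the vertex. *)
Section TightShapes.
Import Order.TTheory GRing.Theory Num.Theory.
Variable n : nat.
Hypothesis n_ge3 : 2 < n.
Implicit Types (A B C X Y : seq int) (a b : int) (q e r k m : nat).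
Local Notation pal la := (palindromic (@omit n false) (shape_elt n false la)).
Local Notation padded := (padded_shape n).
Local Notation reflects_down := (reflects_down n).

Lemma reflects_down_opp A a B : (size A + size B).+1 = n -> (0 < a)%R ->
  reflects_down (1 + \sum_(b <- B) ((`|b| <= `|a|) + (`|b| < `|a|)))
    (A ++ (- a)%R :: B) (A ++ a :: B).
Proof.
move=> sz a_gt0; split; first by rewrite size_cat /= addnS.
  exact: vertex_length_opp.
by have := reflected_coord n_ge3 (- a)%R 0 sz; rewrite mulr0 sub0r opprK.
Qed.

Lemma reflects_down_opp1 A a B : (size A + size B).+1 = n -> (0 < a)%R ->
  all (fun b => `|a| < `|b|) B -> reflects_down 1 (A ++ (- a)%R :: B) (A ++ a :: B).
Proof.
move=> sz a_gt0 largeB; have := reflects_down_opp sz a_gt0.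
rewrite big1_seq ?addn0 // => b /andP[_ /(allP largeB) /= lt].
by rewrite leqNgt lt ltnNge (ltnW lt).
Qed.

Lemma reflects_down_swap A a B b C : (size A + size B + size C).+2 = n -> (a < b)%R ->
  all (fun c => (c < a) || (b < c))%R B ->
  reflects_down 1 (A ++ a :: B ++ b :: C) (A ++ b :: B ++ a :: C).
Proof.
move=> sz lt_ab outB; split; first by size_lia.
  exact: vertex_length_swap.
exact: reflected_swap.
Qed.

Lemma padded_power_stair m k : k < n -> padded (nseq m n ++ staircase k).
Proof.
move=> kn; elim: m => [|m IH] /=.
  apply/andP; split.
    rewrite rev_sorted; apply: sub_sorted (iota_ltn_sorted 1 k) => x y /=.
    by rewrite /padded_rel => ->.
  by rewrite all_rev; apply/allP => x; rewrite mem_iota; lia.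
have le_n : all (leq^~ n) (nseq m n ++ staircase k).
  rewrite all_cat all_nseq leqnn orbT all_rev; apply/allP => x; rewrite mem_iota.
  by rewrite /=; lia.
case: (nseq m n ++ _) IH le_n => [_ _|x la /andP[/= so bd] /andP[lexn _]].
  by rewrite /padded_shape /=; lia.
by rewrite /padded_shape /= so /padded_rel; lia.
Qed.

Lemma padded_power m : padded (nseq m n).
Proof. by have := @padded_power_stair m 0; rewrite cats0; apply; lia. Qed.

Lemma power_residue_not_palindromic q e r : 0 < q -> n = e.+1 + r.+1 ->
  ~ pal (nseq (q * n + r.+1) n).
Proof.
move=> q0 En; have EX := shape_point_power n_ge3 q En.
pose Y1 : seq int := (nseq e (- q%:Z) ++ q%:Z :: nseq r.+1 (- q.+1%:Z))%R.
pose Y2 : seq int := (nseq e.+1 (- q%:Z) ++ nseq r (- q.+1%:Z) ++ [:: q.+1%:Z])%R.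
apply: (not_palindromic_reflections n_ge3 (Ys := [:: Y1; Y2]) (padded_power _) EX _
  (ideal_count1_le n_ge3 _)) => //.
- by size_lia.
- by rewrite /= inE andbT /Y1 /Y2 (nseqSr e) -catA eqseq_cat // eqseq_cons; lia.
move=> Y; rewrite !inE => /orP[]/eqP->.
  by rewrite (nseqSr e) -catA; apply: reflects_down_opp1; rewrite ?all_nseq;
    [size_lia | lia | lia].
by rewrite /Y2 (nseqSr r) !catA; apply: reflects_down_opp1; [size_lia | lia |].
Qed.

Lemma reflects_down_opp2 A a : (size A).+2 = n -> (0 < a)%R ->
  reflects_down 2 (A ++ [:: - a; - a]%R) (A ++ [:: a; - a]%R).
Proof.
move=> sz a_gt0; have := @reflects_down_opp A a [:: (- a)%R].
rewrite big_seq1 abszN leqnn ltnn; apply=> //=.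
by rewrite addn1.
Qed.

Lemma power_multiple_not_palindromic q r : 0 < q -> n = r.+1 ->
  ~ pal (nseq (q * n + r.+1) n).
Proof.
move=> q0 En; have [r' Er] : exists r', r = r'.+1 by exists r.-1; lia.
pose a : int := q.+1%:Z%R; have EX : shape_point n (nseq (q * n + r.+1) n) =
    pt (nseq r.+1 (- a)%R) := shape_point_power n_ge3 q (En : n = 0 + r.+1).
have a_ge2 : (2%:Z <= a)%R by rewrite /a; lia.
move: a a_ge2 EX => a a_ge2 EX.
have EX2 : nseq r.+1 (- a)%R = nseq r' (- a)%R ++ [:: - a; - a]%R.
  by rewrite Er !nseqSr -catA.
pose Y1 : seq int := nseq r' (- a)%R ++ [:: a; - a]%R.
pose Y2 : seq int := nseq r (- a)%R ++ [:: 2%:Z - a]%R.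
apply: (not_palindromic_reflections n_ge3 (Ys := [:: Y1; Y2]) (padded_power _) EX _
  (ideal_count2_le n_ge3 _)) => //.
- by size_lia.
- by rewrite /= inE andbT /Y1 /Y2 Er nseqSr -catA eqseq_cat // eqseq_cons; lia.
move=> Y; rewrite !inE => /orP[]/eqP->.
  by rewrite EX2; apply: reflects_down_opp2; [size_lia | lia].
rewrite nseqSr; split; first by size_lia.
  apply: vertex_length_catl => [c /nseqP[-> _]|].
    by rewrite !big_seq1 /pair_crossings /crossings; lia.
  by rewrite /= !big_nil /crossings; lia.
have := @reflected_coord n n_ge3 (nseq r (- a)%R) (- a)%R (1 - a)%R [::].
rewrite (_ : 2%:Z * (1 - a) - - a = 2%:Z - a)%R; last by lia.
by apply; size_lia.
Qed.

Lemma power_small_not_palindromic e r : n = e.+1 + r.+2 -> ~ pal (nseq r.+2 n).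
Proof.
move=> En; have EX := shape_point_power n_ge3 0 En; rewrite mul0n add0n oppr0 in EX.
pose Y1 : seq int := nseq e.+1 0%R ++ nseq r (- 1)%R ++ [:: 1; - 1]%R.
pose Y2 : seq int := nseq e 0%R ++ 1%R :: nseq r.+1 (- 1)%R ++ [:: 0]%R.
have EX1 : nseq e.+1 0%R ++ nseq r.+2 (- 1)%R =
    (nseq e.+1 0%R ++ nseq r (- 1)%R) ++ [:: - 1; - 1]%R :> seq int.
  by rewrite -catA !nseqSr -!catA.
have EX2 : nseq e.+1 0%R ++ nseq r.+2 (- 1)%R =
    nseq e 0%R ++ 0%R :: nseq r.+1 (- 1)%R ++ [:: - 1]%R :> seq int.
  by rewrite (nseqSr e) (nseqSr r.+1) -!catA.
apply: (not_palindromic_reflections n_ge3 (Ys := [:: Y1; Y2]) (padded_power _) EX _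
  (ideal_count2_le n_ge3 _)) => //.
- by size_lia.
- by rewrite /= inE andbT /Y1 /Y2 (nseqSr e) -catA eqseq_cat // eqseq_cons; lia.
move=> Y; rewrite !inE => /orP[]/eqP->.
  by rewrite EX1 /Y1 catA; apply: reflects_down_opp2; [size_lia | lia].
rewrite EX2; split; first by size_lia.
  apply: vertex_length_catl => [c /nseqP[-> _]|].
    by rewrite !(big_cons, big_cat, big_nil) /= /pair_crossings /crossings; lia.
  have [p01 pd] : pair_crossings 0 (- 1)%R = 1 /\
      pair_crossings (- 1)%R (- 1)%R = pair_crossings (- 1)%R 0 by [].
  move: r.+1 => k; rewrite /= !vertex_length_cat !big_cat /= !big_nseq !iter_addn_0.
  by rewrite !big_seq1 !big_nil p01 pd /pair_crossings /crossings; lia.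
have := @reflected_pair n n_ge3 (nseq e 0%R) 0%R (nseq r.+1 (- 1)%R) (- 1)%R 0%R [::].
by rewrite oppr0 addr0 opprK add0r; apply; size_lia.
Qed.

(* Here coranks 1, 2 and 3 agree with ranks 1, 2 and 3: the first asymmetry is three
   elements of corank 4 against the two shapes (4) and (3,1) of rank 4. *)
Lemma power_square_not_palindromic : 3 < n -> ~ pal (nseq n n).
Proof.
move=> n4; have [r En] : exists r, n = r + 4 by exists (n - 4); lia.
have EX : shape_point n (nseq n n) = pt (nseq n (- 1)%R).
  have := @shape_point_power n n_ge3 0 0 n.-1.
  by rewrite mul0n add0n prednK; [apply | lia].
pose A : seq int := nseq r (- 1)%R.
have EX4 : nseq n (- 1)%R = A ++ [:: - 1; - 1; - 1; - 1]%R :> seq int.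
  by rewrite {1}En nseqD.
pose Y1 : seq int := A ++ [:: 1; - 1; - 1; - 1]%R.
pose Y2 : seq int := A ++ [:: - 1; 1; - 1; 1]%R.
pose Y3 : seq int := A ++ [:: - 1; - 1; 0; 0]%R.
rewrite EX4 in EX.
apply: (not_palindromic_reflections n_ge3 (Ys := [:: Y1; Y2; Y3]) (padded_power _) EX _
  (ideal_count4_le n_ge3 _ n4)) => //.
- by size_lia.
- by rewrite /= !inE /Y1 /Y2 /Y3 !eqseq_cat // eqxx.
have sA : size A = r by rewrite size_nseq.
move=> Y; rewrite !inE => /or3P[]/eqP->; split; rewrite ?size_cat ?sA //;
  try by apply: vertex_length_catl => [c /nseqP[-> _]|];
    rewrite /= !(big_cons, big_nil).
- have := @reflected_coord n n_ge3 A (- 1)%R 0%R [:: - 1; - 1; - 1]%R.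
  by apply; rewrite sA /=; lia.
- have := @reflected_pair n n_ge3 (A ++ [:: - 1])%R (- 1)%R [:: - 1]%R (- 1)%R 0%R [::].
  by rewrite -!catA; apply; rewrite size_cat sA /=; lia.
have := @reflected_pair n n_ge3 (A ++ [:: - 1; - 1])%R (- 1)%R [::] (- 1)%R (- 1)%R [::].
by rewrite -!catA; apply; rewrite size_cat sA /=; lia.
Qed.

Lemma two_coatoms_not_palindromic la a b X Y : padded la ->
  shape_point n la = pt [:: a, b & X] -> size X = n - 2 -> (a < b)%R ->
  head 0%R Y != b -> reflects_down 1 [:: a, b & X] Y -> ~ pal la.
Proof.
move=> vla EX sX lt_ab ne downY.
have sXn : (size X).+2 = n by rewrite sX; lia.
apply: (not_palindromic_reflections n_ge3 (Ys := [:: [:: b, a & X]; Y]) vla EX _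
  (ideal_count1_le n_ge3 _)) => //.
  by rewrite /= inE andbT; apply: contraNneq ne => <-.
move=> Z; rewrite !inE => /orP[]/eqP-> //.
by apply: (@reflects_down_swap [::] a [::] b X).
Qed.

Local Notation power_stair m := (nseq m n ++ staircase (n - 1)).

Lemma padded_full_stair m : padded (power_stair m).
Proof. by apply: padded_power_stair; lia. Qed.

Lemma power_stair_multiple_not_palindromic q r : n = r.+2 ->
  ~ pal (power_stair (q * n + r.+2)).
Proof.
move=> En; have := shape_point_power_stair n_ge3 q (En : n = 0 + r.+2).
rewrite [nseq 0 _]/= cats0 => EX.
apply: (two_coatoms_not_palindromic (padded_full_stair _) EX _ _
  (Y := (q.+1%:Z :: nseq r.+1 q.+2%:Z)%R)) => //; first by size_lia.
  by rewrite /= eqz_nat; lia.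
apply: (@reflects_down_opp1 [::]) => //; first by size_lia.
by rewrite /= all_nseq; lia.
Qed.

Lemma power_stair_residue_not_palindromic q e r : n = e.+1 + r.+2 ->
  ~ pal (power_stair (q * n + r.+2)).
Proof.
move=> En; have EX := shape_point_power_stair n_ge3 q En.
apply: (two_coatoms_not_palindromic (padded_full_stair _) EX _ _
  (Y := (q.+1%:Z :: nseq r.+1 q.+2%:Z ++ - q.+1%:Z :: nseq e q.+1%:Z)%R)) => //.
- by size_lia.
- by rewrite /= eqz_nat; lia.
apply: (@reflects_down_swap [::] _ (nseq r.+1 q.+2%:Z%R)) => //; first by size_lia.
by rewrite all_nseq; lia.
Qed.

Lemma power_stair_residue1_not_palindromic q e : n = e.+2 + 1 ->
  ~ pal (power_stair (q.+1 * n + 1)).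
Proof.
move=> En; have EX : shape_point n (power_stair (q.+1 * n + 1)) =
  pt [:: - q.+2%:Z, q.+2%:Z & nseq e.+1 q.+2%:Z]%R :=
    shape_point_power_stair n_ge3 q.+1 En.
apply: (two_coatoms_not_palindromic (padded_full_stair _) EX _ _
  (Y := [:: - q.+2%:Z, - q%:Z & nseq e.+1 q.+2%:Z]%R)) => //; first by size_lia.
split; first by size_lia.
  have eq_pair : pair_crossings q.+2%:Z%R q.+2%:Z%R =
      pair_crossings (- q%:Z)%R q.+2%:Z%R.
    by rewrite /pair_crossings /crossings; lia.
  rewrite /= !big_cons !big_nseq !iter_addn_0 eq_pair.
  by rewrite /pair_crossings /crossings; lia.
have := @reflected_coord n n_ge3 [:: - q.+2%:Z]%R q.+2%:Z%R 1%R (nseq e.+1 q.+2%:Z%R).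
rewrite (_ : 2%:Z * 1 - q.+2%:Z = - q%:Z)%R; last by lia.
by apply; size_lia.
Qed.

Lemma power_stair_single_not_palindromic e : n = e.+2 + 1 -> ~ pal (power_stair 1).
Proof.
move=> En; have EX : shape_point n (power_stair 1) =
  pt [:: - 1%:Z, 1%:Z, 1%:Z & nseq e 1%:Z]%R := shape_point_power_stair n_ge3 0 En.
apply: (two_coatoms_not_palindromic (padded_full_stair _) EX _ _
  (Y := [:: - 1%:Z, 0, 0 & nseq e 1%:Z]%R)) => //; first by size_lia.
split; first by size_lia.
  have pairs : (pair_crossings 1 1 = 1) * (pair_crossings 0 1 = 1) *
      (pair_crossings 0 0 = 0) * (pair_crossings (- 1)%R 0 = 2) *
      (pair_crossings (- 1)%R 1 = 2) by [].
  by rewrite /= !big_cons !big_nseq !iter_addn_0 !pairs /crossings; lia.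
have := @reflected_pair n n_ge3 [:: - 1%:Z]%R 1%R [::] 1%R 1%R (nseq e 1%:Z%R).
by apply; size_lia.
Qed.

Lemma power_stair_not_palindromic q e r : n = e + r.+1 ->
  ~ pal (power_stair (q * n + r.+1)).
Proof.
case: r => [|r] En.
  have Ee : e = (e - 2).+2 by lia.
  rewrite Ee in En; case: q => [|q].
    by rewrite mul0n add0n; apply: power_stair_single_not_palindromic En.
  exact: power_stair_residue1_not_palindromic En.
case: e En => [|e] En; first exact: power_stair_multiple_not_palindromic.
exact: power_stair_residue_not_palindromic En.
Qed.

End TightShapes.

Section PalindromicShapes.
Variable n : nat.
Hypothesis n_ge3 : 2 < n.
Implicit Types (la mu : seq nat) (v w : affB n).
Local Notation elt := (shape_elt n false).
Local Notation pal la := (palindromic (@omit n false) (shape_elt n false la)).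
Local Notation padded := (padded_shape n).

Lemma pred_divn_eq m : 0 < m ->
  exists q e r, n = e + r.+1 /\ m = q * n + r.+1.
Proof.
move=> m0; have lt : m.-1 %% n < n by rewrite ltn_mod; lia.
exists (m.-1 %/ n), (n - (m.-1 %% n).+1), (m.-1 %% n); rewrite subnK //.
by rewrite addnS -divn_eq prednK.
Qed.

Lemma power_palindromic m : 1 < m -> pal (nseq m n) -> n = 3 /\ m = 3.
Proof.
move=> m1 pa; have [q [e [r [En Em]]]] := pred_divn_eq (ltnW m1); rewrite Em in m1 pa *.
have [q0|q0] := posnP q; case: e En => [|e] En.
- rewrite q0 mul0n add0n -[r.+1]/(0 + r.+1) -En in pa *.
  by have [n4|] := ltnP 3 n; [case: (power_square_not_palindromic n_ge3 n4 pa) | lia].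
- rewrite q0 mul0n add0n in m1 pa; case: r m1 pa En {Em} => // r _ pa En.
  by case: (power_small_not_palindromic n_ge3 En pa).
- by case: (power_multiple_not_palindromic n_ge3 q0 En pa).
- by case: (power_residue_not_palindromic n_ge3 q0 En pa).
Qed.

Lemma palindromic_shape la : padded la -> all (leq 1) la -> pal la ->
  [\/ exists2 j, j < 2 * n & la = one_row j,
      exists2 k, 1 < k < n & la = staircase k |
      n = 3 /\ la = [:: 3; 3; 3]].
Proof.
move=> vla pos pa.
have [so|ns] := boolP (sorted (tight_rel n) la); last first.
  by case: (not_tight_not_palindromic n_ge3 vla pos ns).
case/lastP: la vla pos pa so => [|l p]; first by constructor 1; exists 0; [lia|].
case/lastP: l => [|l a] vla pos pa so.
  constructor 1; exists p; first by case/andP: vla => _ /= /andP[].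
  by rewrite /one_row; case: eqP pos => //= ->.
have p0 : 0 < p by move: pos; rewrite all_rcons => /andP[].
have [p1|p1] := ltnP 1 p.
  have [/andP[/eqP Ea /eqP Ep]|ne] := boolP ((a == n) && (p == n)).
    constructor 3; rewrite Ep in so pa *; rewrite (tight_end_n n_ge3 so) in pa *.
    have [] := power_palindromic _ pa; first by rewrite size_rcons.
    by move=> En ->; rewrite En.
  rewrite -cats1 cat_rcons in vla pa so.
  have r : tight_rel n a p by move: so; rewrite sorted_cat_cons /= => /and3P[].
  by case: (tight_corank2_not_palindromic n_ge3 vla r p1 ne).
have Ep : p = 1 by lia.
have [|[k lek E]|[m m0 E]] := @tight_end n n_ge3 (rcons l a) p _ so.
- by lia.
- constructor 2; exists k; last by rewrite E Ep /staircase; congr (rev (iota _ _)); lia.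
  have := congr1 size E; rewrite !size_rcons size_rev size_iota; lia.
have [q [e [r [En Em]]]] := pred_divn_eq m0; rewrite E Ep Em in pa.
by case: (power_stair_not_palindromic n_ge3 En pa).
Qed.

Lemma segment_palindromic j : j < 2 * n ->
  palindromic (@omit n false) (segment n false j).
Proof.
move=> lt; have [mj ej] := segment_min_rep n_ge3 false lt.
have ell_seg i : i <= j -> ell (segment n false i) = i.
  by move=> le; have [_] := segment_min_rep n_ge3 false (leq_ltn_trans le lt).
pose L := [seq segment n false i | i <- iota 0 j.+1].
have memL v : v \in L <-> min_rep (omit false) v /\ bruhat v (segment n false j).
  split=> [/mapP[i]|[mv bv]].
    rewrite mem_iota ltnS => /= le ->; split.
      by have [] := segment_min_rep n_ge3 false (leq_ltn_trans le lt).
    rewrite !segmentE; apply: subword_bruhat.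
      by apply: map_subseq; apply: segment_word_subseq.
    by rewrite /reduced size_map size_segment_word // -segmentE.
  have pv := bruhat_parabolic (segment_parabolic n_ge3 false lt) bv.
  have [i lti Ev] := parabolic_min_segment n_ge3 mv pv; rewrite Ev; apply: map_f.
  have [_ ei] := segment_min_rep n_ge3 false lti.
  by have := bruhat_ell bv; rewrite Ev ei ej mem_iota.
have uL : uniq L.
  rewrite map_inj_in_uniq ?iota_uniq // => i k; rewrite !mem_iota !ltnS => /= lei lek.
  by move=> /(congr1 ell); rewrite !ell_seg.
have count1 i : i <= j -> ideal_count (omit false) (segment n false j) i = 1.
  move=> le; rewrite (ideal_count_enum i uL memL) count_map.
  rewrite (@eq_in_count _ _ (pred1 i)) => [|k]; last first.
    by rewrite mem_iota ltnS => /= lek; rewrite ell_seg.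
  by rewrite count_uniq_mem ?iota_uniq // mem_iota ltnS le.
by apply/palindromicE => i; rewrite ej => le; rewrite !count1 // leq_subr.
Qed.

Lemma one_row_palindromic j : j < 2 * n -> pal (one_row j).
Proof.
move=> lt; rewrite /one_row; case: posnP => [_|_].
  by apply: (@segment_palindromic 0); lia.
exact: segment_palindromic.
Qed.

Lemma padded_shape_cat0 la r : padded la -> padded (la ++ nseq r 0).
Proof.
elim: r la => [|r IH] la v; first by rewrite cats0.
rewrite -[nseq r.+1 0]/(0 :: nseq r 0) -cat_rcons; apply: IH.
case/andP: v => so bd; rewrite /padded_shape all_rcons bd andbT.
apply/andP; split; last by lia.
by case: la so {bd} => //= x la so; rewrite rcons_path so /padded_rel; lia.
Qed.

Lemma shape_elt_pos_inj la mu : padded la -> padded mu ->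
  all (leq 1) la -> all (leq 1) mu -> elt la = elt mu -> la = mu.
Proof.
move=> v v' pos pos' eq_elt.
have filter_pos l r : all (leq 1) l -> [seq j <- l ++ nseq r 0 | 0 < j] = l.
  by move=> /all_filterP pos_l; rewrite filter_cat pos_l filter_nseq /= cats0.
rewrite -(filter_pos la (size mu) pos) -[in RHS](filter_pos mu (size la) pos').
congr filter; apply: (@shape_elt_inj n n_ge3 false).
- by rewrite !size_cat !size_nseq addnC.
- exact: padded_shape_cat0.
- exact: padded_shape_cat0.
by rewrite !shape_elt_cat0.
Qed.

Lemma staircaseS k : staircase k.+1 = k.+1 :: staircase k.
Proof. by rewrite /staircase -[in LHS](addn1 k) iotaD rev_cat. Qed.

Lemma staircase_sorted k : sorted gtn (staircase k).
Proof. by rewrite /staircase rev_sorted iota_ltn_sorted. Qed.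

Lemma mem_staircase k j : (j \in staircase k) = (0 < j <= k).
Proof. by rewrite mem_rev mem_iota add1n ltnS. Qed.

Lemma strict_contained k l : sorted gtn l -> all (fun j => 0 < j <= k) l ->
  size l <= k /\ all2 leq (l ++ nseq (k - size l) 0) (staircase k).
Proof.
elim: k l => [|k IH] [|a l] //=; first by rewrite andbC; lia.
  by move=> _ _; split=> //; rewrite staircaseS /=; have [] := IH [::] isT isT;
    rewrite subn0.
move=> so /andP[lea al]; have [|le le2] := IH l (path_sorted so).
  apply/allP => j jl; have := allP al j jl.
  have /= := allP (order_path_min gtn_trans so) j jl.
  by lia.
by split=> //; rewrite staircaseS /= subSS le2 andbT; lia.
Qed.

Lemma strict_padded k l : k < n -> sorted gtn l -> all (fun j => j <= k) l -> padded l.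
Proof.
move=> kn so al; apply/andP; split.
  by apply: sub_sorted so => x y /=; rewrite /padded_rel => ->.
by apply: sub_all al => j /=; lia.
Qed.

Lemma padded_strict k l : k < n -> padded l -> all (fun j => 0 < j <= k) l ->
  sorted gtn l.
Proof.
move=> kn /andP[so _]; case: l so => //= a l.
elim: l a => //= c l IH a /andP[r so] /andP[a_bd al].
by rewrite IH // andbT; move: r; rewrite /padded_rel; lia.
Qed.

Lemma strict_subseq_staircase k mu : sorted gtn mu -> all (fun j => 0 < j <= k) mu ->
  subseq mu (staircase k).
Proof.
move=> so al; suff <- : [seq j <- staircase k | j \in mu] = mu.
  exact: filter_subseq.
apply: (irr_sorted_eq gtn_trans ltnn) => //.
  exact: (sorted_filter gtn_trans _ (staircase_sorted k)).
move=> j; rewrite mem_filter mem_staircase; case jmu : (j \in mu) => //=.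
exact: (allP al).
Qed.

Section Staircase.
Variable k : nat.
Hypothesis k_bounds : 0 < k < n.
Local Notation la := (staircase k).

Lemma subseq_staircase mu : subseq mu la ->
  [/\ sorted gtn mu, all (fun j => 0 < j <= k) mu & padded mu].
Proof.
move=> sub; have so : sorted gtn mu.
  exact: (subseq_sorted gtn_trans sub (staircase_sorted k)).
have al : all (fun j => 0 < j <= k) mu.
  by apply/allP => j /(mem_subseq sub); rewrite mem_staircase.
split=> //; apply: (@strict_padded k) => //; first by case/andP: k_bounds.
by apply: sub_all al => j /andP[].
Qed.

Lemma bruhat_subseq_staircase mu : subseq mu la -> bruhat (elt mu) (elt la).
Proof.
move=> sub; have [so al vmu] := subseq_staircase sub.
have [le le2] := strict_contained so al.
rewrite -(shape_elt_cat0 n false mu (k - size mu)); apply: bruhat_contained => //.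
  by have [] := subseq_staircase (subseq_refl la).
exact: padded_shape_cat0.
Qed.

Lemma shape_word_letters b l : padded l ->
  all (fun i : 'I_n.+1 => i <= k) (shape_word n b l) = all (leq^~ k) l.
Proof.
elim: l b => //= j l IH b /padded_shape_behead[v lt]; rewrite all_cat IH // andbC.
congr (_ && _); rewrite all_map; apply/allP/idP => [le_k|lejk i] /=.
  rewrite leqNgt; apply/negP => ltkj; have := le_k k.+1.
  have -> : k.+1 \in segment_word n j.
    apply: (mem_subseq (segment_word_subseq n_ge3 ltkj lt)).
    by rewrite segment_word_low ?mem_staircase //; lia.
  rewrite /= (_ : relabel b k.+1 = k.+1) ?inordK; [by move/(_ isT); lia | lia |].
  by rewrite /relabel; case: eqP => // ?; lia.
rewrite segment_word_low ?mem_staircase; last by lia.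
move=> lei; suff le_relabel : relabel b i <= k by rewrite inordK //; lia.
by rewrite /relabel; case: eqP => _; [case: (b); lia | lia].
Qed.

(* An element below the staircase lies in the parabolic subgroup of s_0, s_2,
   ..., s_k and s_1, so its reduced words have no other letters. *)
Lemma subseq_staircase_of_bruhat mu : padded mu -> all (leq 1) mu ->
  bruhat (elt mu) (elt la) -> subseq mu la.
Proof.
move=> vmu pos le_mu; pose K (i : 'I_n.+1) := (i : nat) <= k.
have [_ al vla] := subseq_staircase (subseq_refl la).
have Kla : parabolic K (elt la).
  apply: parabolic_wprod; rewrite shape_word_letters //.
  by apply: sub_all al => j /andP[].
have [_ emu] := shape_elt_min_rep n_ge3 false vmu.
have := reduced_word_support (affB_gen_inj n_ge3) (bruhat_parabolic Kla le_mu).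
rewrite /reduced emu size_shape_word // shape_word_letters // => /(_ erefl) lek.
have bd : all (fun j => 0 < j <= k) mu.
  by apply/allP => j jmu; rewrite (allP pos j jmu) (allP lek j jmu).
apply: (strict_subseq_staircase _ bd); apply: (padded_strict _ vmu bd).
by case/andP: k_bounds.
Qed.

Definition staircase_ideal := [seq elt (mask m la) | m : k.-tuple bool <- enum {: k.-tuple bool}].

Lemma staircase_ideal_uniq : uniq staircase_ideal.
Proof.
rewrite map_inj_uniq ?enum_uniq // => m m' eq_elt.
apply/val_inj/(@mask_uniq_inj _ la); rewrite ?size_tuple ?size_rev ?size_iota //.
  by rewrite rev_uniq iota_uniq.
have [_ al v] := subseq_staircase (mask_subseq m la).
have [_ al' v'] := subseq_staircase (mask_subseq m' la).
by apply: shape_elt_pos_inj => //;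
  [apply: sub_all al | apply: sub_all al'] => j /andP[].
Qed.

Lemma mem_staircase_ideal v :
  v \in staircase_ideal <-> min_rep (omit false) v /\ bruhat v (elt la).
Proof.
split=> [/mapP[m _ ->]|[mv le_v]].
  have [_ _ vm] := subseq_staircase (mask_subseq m la).
  have [mm _] := shape_elt_min_rep n_ge3 false vm.
  by split; [|apply/bruhat_subseq_staircase/mask_subseq].
have [mu [vmu pos Ev]] := min_rep_shape n_ge3 mv; rewrite Ev in le_v *.
have /subseqP[m sm Em] := subseq_staircase_of_bruhat vmu pos le_v.
have smk : size m == k by rewrite sm size_rev size_iota.
by apply/mapP; exists (Tuple smk); rewrite ?mem_enum //= -Em.
Qed.

Lemma staircase_palindromic : pal la.
Proof.
have [_ _ vla] := subseq_staircase (subseq_refl la).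
have [_ ela] := shape_elt_min_rep n_ge3 false vla.
pose neg (m : k.-tuple bool) : k.-tuple bool := [tuple of map negb m].
have negK : involutive neg.
  move=> m; apply: val_inj => /=; rewrite -map_comp -[RHS]map_id.
  by apply: eq_map => b /=; rewrite negbK.
have perm_neg : perm_eq (enum {: k.-tuple bool}) (map neg (enum {: k.-tuple bool})).
  apply: uniq_perm; rewrite ?(map_inj_uniq (inv_inj negK)) ?enum_uniq // => m.
  by rewrite -{2}(negK m) (mem_map (inv_inj negK)) !mem_enum.
apply/palindromicE => i; rewrite ela => le.
rewrite !(ideal_count_enum _ staircase_ideal_uniq mem_staircase_ideal).
rewrite [LHS]count_map [RHS]count_map (permP perm_neg) [LHS]count_map.
apply: eq_count => m /=.
have ell_mask (p : k.-tuple bool) : ell (elt (mask p la)) = sumn (mask p la).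
  have [_ _ vp] := subseq_staircase (mask_subseq p la).
  by have [] := shape_elt_min_rep n_ge3 false vp.
have := @sumn_mask_negb la m; rewrite size_tuple size_rev size_iota => /(_ erefl).
by rewrite (ell_mask m) (ell_mask (neg m)) /=; lia.
Qed.

End Staircase.

End PalindromicShapes.

Lemma subseq_rows_word_split n b (cs : seq (seq nat)) u :
  subseq u (rows_word n b cs) ->
  exists2 ds, all2 (fun d c => subseq d c) ds cs & u = rows_word n b ds.
Proof.
elim: cs b u => [|c cs IH] b u; first by rewrite subseq0 => /eqP->; exists [::].
case/subseq_cat_split=> u1 [u2 [/IH[ds sub ->] /subseqP[m _ ->] ->]].
exists (mask m c :: ds); first by rewrite /= mask_subseq.
by rewrite /= /colored_word map_mask.
Qed.

Lemma all2_subseq_bounds (n : nat) (ds cs : seq (seq nat)) :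
  all2 (fun d c => subseq d c) ds cs ->
  all (all (fun k => 0 < k <= n)) cs -> all (all (fun k => 0 < k <= n)) ds.
Proof.
elim: ds cs => [|d ds IH] [|c cs] //= /andP[dc sub] /andP[bc bcs].
rewrite (IH _ sub bcs) andbT.
by apply/allP => k /(mem_subseq dc); apply: (allP bc).
Qed.

Lemma passes_out (n : nat) (cs : seq (seq nat)) x k : 2 < n ->
  all (all (fun i => 0 < i <= n)) cs -> n <= k -> foldl (pass n) x cs k = x k.
Proof.
move=> n_ge3 al nk; elim: cs x al => //= c cs IH x /andP[bc bcs]; rewrite IH // /pass.
elim: c bc => [|i c IHc] /=; first by rewrite /flip gtn_eqF //; lia.
by case/andP=> lei bc; rewrite point_act_out ?IHc //; case/andP: lei.
Qed.

Section Square.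
Local Notation elt := (shape_elt 3 false).
Local Notation segw := (segment_word 3).
Local Notation square := [:: 3; 3; 3].
Local Notation n3 := (isT : 2 < 3).

(* Found by enumerating the 512 subwords; rows are padded to three with zeros. *)
Definition square_ideal : seq (seq nat) :=
  [:: [:: 0; 0; 0]; [:: 1; 0; 0]; [:: 2; 0; 0]; [:: 3; 0; 0]; [:: 2; 1; 0];
      [:: 4; 0; 0]; [:: 3; 1; 0]; [:: 3; 2; 0]; [:: 5; 0; 0]; [:: 3; 3; 0];
      [:: 3; 2; 1]; [:: 3; 3; 1]; [:: 3; 3; 2]; [:: 3; 3; 3]].

Lemma square_ideal_padded g : g \in square_ideal -> padded_shape 3 g /\ size g = 3.
Proof.
move=> gI; have : all (fun g => padded_shape 3 g && (size g == 3)) square_ideal by vm_compute.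
by move/allP/(_ g gI)/andP => [-> /eqP].
Qed.

Lemma square_ideal_uniq : uniq [seq elt g | g <- square_ideal].
Proof.
rewrite map_inj_in_uniq // => g g' /square_ideal_padded[v sz] /square_ideal_padded[v' sz'].
by apply: (shape_elt_inj n3); rewrite ?sz ?sz'.
Qed.

(* The vertex (-1, -1, -1) of the square is reflected in x_1 + x_2 = -1. *)
Lemma five_le_square : bruhat (elt [:: 5; 0; 0]) (elt square).
Proof.
have [m3 _] := shape_elt_min_rep n3 false (isT : padded_shape 3 square).
have [m5 _] := shape_elt_min_rep n3 false (isT : padded_shape 3 [:: 5; 0; 0]).
have square_vertex := shape_elt_vertex n3 false (isT : padded_shape 3 square).
have five_vertex := shape_elt_vertex n3 false (isT : padded_shape 3 [:: 5; 0; 0]).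
have square_point : shape_point 3 square = pt [:: - 1; - 1; - 1]%R.
  exact: (@shape_point_power 3 n3 0 0 2).
have five_point : shape_point 3 [:: 5; 0; 0] = pt [:: - 1; 0; 0]%R.
  by apply/funext => -[|[|[|k]]] //; rewrite /pt /= nth_nil.
have refl : reflected 3 (pt [:: - 1; - 1; - 1]%R) (pt [:: - 1; 0; 0]%R).
  exact: (@reflected_pair 3 n3 [:: - 1]%R (- 1)%R [::] (- 1)%R (- 1)%R [::]).
have [||v [mv le_v Ev]] := @bruhat_reflected 3 n3 false _
  (twist 1 (false (+) ~~ odd 3) (pt [:: - 1; 0; 0]%R)) m3.
- by rewrite square_vertex square_point; apply: reflected_twist refl.
- by rewrite square_vertex square_point !vertex_rank_twist //
    !vertex_rank_pt //= !(big_cons, big_nil).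
by rewrite (affB_vertex_inj n3 m5 mv) // Ev five_vertex five_point.
Qed.

Lemma square_ideal_le g : g \in square_ideal -> bruhat (elt g) (elt square).
Proof.
move=> gI; have [vg _] := square_ideal_padded gI.
have : all (fun g => all2 leq g square || all2 leq g [:: 5; 0; 0]) square_ideal by [].
move/allP/(_ g gI)/orP => [le|le]; first exact: bruhat_contained.
by apply: bruhat_trans five_le_square; apply: bruhat_contained.
Qed.

Definition row_subwords : seq (seq nat) :=
  [:: [::]; [:: 1]; [:: 2]; [:: 3]; [:: 2; 1]; [:: 3; 1]; [:: 3; 2]; [:: 3; 2; 1]].

Lemma mem_row_subwords c : subseq c [:: 3; 2; 1] -> c \in row_subwords.
Proof.
case/subseqP=> m sm ->.
by case: m sm => [|[] [|[] [|[] [|]]]].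
Qed.

Definition square_subwords : seq (seq (seq nat)) :=
  [seq c :: p | c <- row_subwords,
    p <- [seq [:: d; e] | d <- row_subwords, e <- row_subwords]].

Lemma mem_square_subwords (cs : seq (seq nat)) :
  all2 (fun c' c => subseq c' c) cs (map segw square) -> cs \in square_subwords.
Proof.
move=> sub; have sz : size cs = 3 by move: sub; rewrite all2E => /andP[/eqP].
case: cs sz sub => [|c [|d [|e [|]]]] // _ /andP[sub_c /andP[sub_d /andP[sub_e _]]].
apply: allpairs_f; first by rewrite mem_row_subwords.
by apply: allpairs_f; rewrite mem_row_subwords.
Qed.

Definition coords (x : nat -> int) : seq int := [:: x 0; x 1; x 2].

Lemma square_subwords_coords :
  all (fun cs => has (fun g => coords (foldl (pass 3) origin cs) == coords (shape_point 3 g))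
    square_ideal) square_subwords.
Proof. by vm_compute. Qed.

Lemma square_subword_point (cs : seq (seq nat)) :
  all2 (fun c' c => subseq c' c) cs (map segw square) ->
  exists2 g, g \in square_ideal & foldl (pass 3) origin cs = shape_point 3 g.
Proof.
move=> sub; have /hasP[g gI /eqP[eq0 eq1 eq2]] :=
  allP square_subwords_coords _ (mem_square_subwords sub).
exists g => //; apply/funext => -[|[|[|k]]] //; have [vg _] := square_ideal_padded gI.
rewrite /shape_point !passes_out //; first exact: segment_words_bounds.
exact: all2_subseq_bounds sub (segment_words_bounds n3 (isT : padded_shape 3 square)).
Qed.

Lemma mem_square_ideal v :
  v \in [seq elt g | g <- square_ideal] <-> min_rep (omit false) v /\ bruhat v (elt square).
Proof.
split=> [/mapP[g gI ->]|[mv le_v]].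
  have [vg _] := square_ideal_padded gI; have [mg _] := shape_elt_min_rep n3 false vg.
  by split; [|apply: square_ideal_le].
have [u] := bruhat_subword le_v erefl.
rewrite shape_wordE => /subseq_rows_word_split[cs sub ->] Ev.
have [g gI Eg] := square_subword_point sub; apply/mapP; exists g => //.
have [vg sg] := square_ideal_padded gI.
have [mg _] := shape_elt_min_rep n3 false vg.
have bsq := segment_words_bounds n3 (isT : padded_shape 3 square).
have szcs : size cs = 3 by move: sub; rewrite all2E => /andP[/eqP].
apply: (affB_vertex_inj n3 mv mg); rewrite shape_elt_vertex // -Ev affB_act_wprod //.
by rewrite foldr_rows_word ?(all2_subseq_bounds sub bsq) // Eg szcs sg.
Qed.

Lemma square_palindromic : palindromic (omit false) (elt square).
Proof.
have [_ ell_sq] := shape_elt_min_rep n3 false (isT : padded_shape 3 square).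
have countE i : ideal_count (omit false) (elt square) i =
    count (fun g => sumn g == i) square_ideal.
  rewrite (ideal_count_enum i square_ideal_uniq mem_square_ideal) count_map.
  apply: eq_in_count => g /square_ideal_padded[vg _] /=.
  by have [_ ->] := shape_elt_min_rep n3 false vg.
apply/palindromicE => i; rewrite ell_sq !countE.
by do 10 (case: i => [|i] //).
Qed.

End Square.

(** * Classification *)

Lemma palindromic_affB_pi n (w : affB n) : 2 < n -> min_rep (omit false) w ->
  palindromic (@omit n false) w <->
  [\/ exists2 j, j < 2 * n & affB_pi w = one_row j,
      exists2 k, 1 < k < n & affB_pi w = staircase k |
      n = 3 /\ affB_pi w = [:: 3; 3; 3]].
Proof.
move=> n_ge3 mw; have [v pos Ew] := affB_pi_shape n_ge3 mw.
split=> [pal|shape]; first by apply: palindromic_shape => //; rewrite -Ew.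
suff : palindromic (@omit n false) (shape_elt n false (affB_pi w)) by rewrite -Ew.
case: shape => [[j lt ->]|[k /andP[k1 kn] ->]|[En ->]].
- exact: one_row_palindromic.
- by apply: staircase_palindromic => //; rewrite (ltnW k1).
- by clear -En; subst n; apply: square_palindromic.
Qed.

Theorem theorem5p12 (n : nat) (w : affB n) (hw : min_rep (@omit n false) w) :
  (4 <= n ->
     (palindromic (@omit n false) w <->
        (exists j : nat, j < 2 * n /\ affB_pi w = one_row j) \/
        (exists k : nat, 1 < k < n /\ affB_pi w = staircase k)))
  /\
  (n = 3 ->
     (palindromic (@omit n false) w <->
        [\/ exists j : nat, affB_pi w = one_row j,
            affB_pi w = [:: 2; 1] |
            affB_pi w = [:: 3; 3; 3]])).
Proof.
split=> [n4|En]; rewrite palindromic_affB_pi ?En ?(ltnW n4) //; split.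
- case=> [[j lt E]|[k lek E]|[En _]]; first by left; exists j.
    by right; exists k.
  by rewrite En in n4.
- case=> [[j [lt E]]|[k [lek E]]]; first by constructor 1; exists j.
  by constructor 2; exists k.
- case=> [[j lt E]|[k lek E]|[_ E]]; [by constructor 1; exists j | | by constructor 3].
  by constructor 2; rewrite E (_ : k = 2) //; lia.
case=> [[j E]|E|E]; [constructor 1; exists j => // | | by constructor 3].
  have n_ge3 : 2 < n by rewrite En.
  have [/andP[_ bd] _ _] := affB_pi_shape n_ge3 hw.
  by move: bd; rewrite E /one_row; case: posnP => [->|_] /=; lia.
by constructor 2; exists 2; rewrite ?E // En.
Qed.
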